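(* Let $s \geq 5$ and $3 \le r \leq 2s-4$ be fixed integers, and let $k = \lfloor r/2 \rfloor$. Then, as $n \to \infty$, $$\mathrm{sat}(n,C_r,K_s) = \Theta\left(n^{\lfloor r/2\rfloor}\right).$$ More precisely, if $r$ is even, then $$\left(\frac{(s-2)_k}{4k}\right)\left(n^k - o(n^k)\right) \leq \mathrm{sat}(n,C_r,K_s) \leq \left(\frac{(s-2)_k}{2k}\right)\left(n^k + o(n^k)\right),$$ and if $r$ is odd, then $$\left(\frac{(s-2)_{k+1}\,(k-2)!}{r(r-3)\,(r)_k\,(s-1)}\right)\left(n^k - o(n^k)\right) \leq \mathrm{sat}(n,C_r,K_s) \leq \left(\frac{(s-2)_{k+1}}{2}\right)\left(n^k + o(n^k)\right),$$ where the explicit lower bound in the odd case is for $r \geq 5$.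
   Context: All graphs are finite and simple. A graph $G$ is $F$-free if it contains no (not necessarily induced) subgraph isomorphic to $F$. $G$ is $F$-saturated if $G$ is $F$-free but adding any nonedge to $G$ creates at least one copy of $F$. A copy of $H$ in $G$ is a (not necessarily induced) subgraph of $G$ isomorphic to $H$. $\mathrm{sat}(n,H,F)$ denotes the minimum number of copies of $H$ in an $n$-vertex $F$-saturated graph. $K_m$ is the complete graph on $m$ vertices and $C_m$ is the cycle on $m$ vertices. $(m)_k = m(m-1)\cdots(m-k+1)$ is the falling factorial. Asymptotic notation is with respect to $n\to\infty$, with $r,s$ fixed (implied constants and $o(\cdot)$ terms may depend on $r,s$). *)

(* Defs.v *)
From HB Require Import structures.
From mathcomp Require Import all_boot.
Set Implicit Arguments.
Unset Strict Implicit.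
Unset Printing Implicit Defensive.

(* A simple graph on the vertex type T, given by its set of edges, each edge
   being a two-element set of vertices. *)
Record sgraph (T : finType) := SGraph {
  edges : {set {set T}};
  edges_card2 : [forall e in edges, #|e| == 2] }.

HB.instance Definition _ (T : finType) := [isSub for @edges T].
HB.instance Definition _ (T : finType) := [Equality of sgraph T by <:].
HB.instance Definition _ (T : finType) := [Choice of sgraph T by <:].
HB.instance Definition _ (T : finType) := [Countable of sgraph T by <:].
HB.instance Definition _ (T : finType) := [Finite of sgraph T by <:].

Lemma mkgraph_subproof (T : finType) (E : {set {set T}}) :
  [forall e in [set e in E | #|e| == 2], #|e| == 2].
Proof. by apply/'forall_implyP => e; rewrite inE => /andP[]. Qed.

(* Members of E that are not two-element sets are discarded. *)
Definition mkgraph (T : finType) (E : {set {set T}}) : sgraph T :=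
  SGraph (mkgraph_subproof E).

Definition complete_graph (m : nat) : sgraph 'I_m := mkgraph setT.

(* The cycle 0, 1, ..., m-1, 0; ordS is the cyclic successor on 'I_m.
   It is the graph C_m only for 3 <= m. *)
Definition cycle_graph (m : nat) : sgraph 'I_m :=
  mkgraph [set [set i; ordS i] | i : 'I_m].

(* A subgraph of G is a pair (W, D) of a vertex set and an edge set. *)
Definition is_subgraph (T : finType) (G : sgraph T)
    (S : {set T} * {set {set T}}) : bool :=
  (S.2 \subset edges G) && [forall e in S.2, e \subset S.1].

Definition isomorphic_to (U T : finType) (H : sgraph U)
    (S : {set T} * {set {set T}}) : bool :=
  [exists f : {ffun U -> T},
    [&& injectiveb f, [set f u | u : U] == S.1
      & [set [set f u | u in e] | e : {set U} in edges H] == S.2]].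

(* Copies are counted as subgraphs, not as embeddings. *)
Definition copies (U T : finType) (H : sgraph U) (G : sgraph T) :
    {set {set T} * {set {set T}}} :=
  [set S | is_subgraph G S & isomorphic_to H S].

Definition ncopies (U T : finType) (H : sgraph U) (G : sgraph T) : nat :=
  #|copies H G|.

Definition is_free (U T : finType) (F : sgraph U) (G : sgraph T) : bool :=
  copies F G == set0.

Definition add_edge (T : finType) (G : sgraph T) (e : {set T}) : sgraph T :=
  mkgraph (e |: edges G).

Definition saturated (U T : finType) (F : sgraph U) (G : sgraph T) : bool :=
  is_free F G &&
  [forall e : {set T}, (#|e| == 2) && (e \notin edges G) ==>
     ~~ is_free F (add_edge G e)].

(* The value 0 is a junk value for the case that no F-saturated graph on n
   vertices exists; by saturated_ex this never happens when F has an edge, and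
   then sat_number_attained and sat_number_le make sat_number a minimum. *)
Definition sat_number (U W : finType) (n : nat) (H : sgraph U)
    (F : sgraph W) : nat :=
  if [pick G : sgraph 'I_n | saturated F G] is Some G0 then
    ncopies H [arg min_(G < G0 | saturated F G) ncopies H G]
  else 0.

Lemma sat_number_attained (U W : finType) (n : nat) (H : sgraph U) (F : sgraph W) :
  (exists G : sgraph 'I_n, saturated F G) ->
  exists2 G : sgraph 'I_n, saturated F G & ncopies H G = sat_number n H F.
Proof.
case=> G satG; rewrite /sat_number; case: pickP => [G0 satG0|/(_ G)]; last first.
  by rewrite satG.
by case: arg_minnP => // G1 satG1 _; exists G1.
Qed.

Lemma sat_number_le (U W : finType) (n : nat) (H : sgraph U) (F : sgraph W)
  (G : sgraph 'I_n) : saturated F G -> sat_number n H F <= ncopies H G.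
Proof.
move=> satG; rewrite /sat_number; case: pickP => [G0 satG0|/(_ G)] //.
by case: arg_minnP => // G1 _; apply.
Qed.

Lemma empty_free (U T : finType) (F : sgraph U) :
  edges F != set0 -> is_free F (mkgraph (set0 : {set {set T}})).
Proof.
case/set0Pn=> e eF; apply/eqP/setP => -[W D]; rewrite !inE /=.
apply/negP => /andP[/andP[/= DG _] /existsP[f /and3P[_ _ /eqP/= DE]]].
have : [set f u | u in e] \in D by rewrite -DE; apply: imset_f.
by move/(subsetP DG); rewrite !inE.
Qed.

(* A free graph with the maximum number of edges is saturated. *)
Lemma saturated_ex (U : finType) (F : sgraph U) (n : nat) :
  edges F != set0 -> exists G : sgraph 'I_n, saturated F G.
Proof.
move=> /(@empty_free _ 'I_n); set G0 := mkgraph _ => freeG0.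
case: (@arg_maxnP _ G0 (fun G : sgraph 'I_n => is_free F G) (fun G => #|edges G|)) => //.
move=> G freeG maxG; exists G; rewrite /saturated freeG /=.
apply/forallP => e; apply/implyP => /andP[e2 eG]; apply/negP => /maxG.
apply/negP; rewrite -ltnNge; apply: proper_card; apply/properP; split.
  apply/subsetP => d dG; rewrite !inE dG orbT /=.
  by have /'forall_implyP/(_ d dG) := edges_card2 G.
by exists e => //; rewrite !inE eqxx.
Qed.

Lemma complete_saturated_ex (s n : nat) :
  2 <= s -> exists G : sgraph 'I_n, saturated (complete_graph s) G.
Proof.
case: s => [|[|s]] // _; apply: saturated_ex; apply/set0Pn.
by exists [set ord0; ord_max]; rewrite !inE cards2.
Qed.

(* Main.v *)
Require Import Defs.
From mathcomp Require Import all_boot all_order all_algebra.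
From mathcomp Require Import zify.
Set Implicit Arguments.
Unset Strict Implicit.
Unset Printing Implicit Defensive.

(** Throughout, t is s - 2, n is the number of vertices and k is the integer
part of r / 2.  Cycles are counted through their labellings: the cycle graph
has 2r automorphisms, so a graph has 2r times as many labelled r-cycles as
copies of it ([card_embeddings]).

Upper bound.  The join of a t-clique with an empty graph is saturated
([join_saturated]).  The positions at which a labelled r-cycle visits the empty
part contain no two cyclically consecutive indices.  There are therefore at
most k of them, and when there are exactly k, their set is one of at most 2
sets (r even) or of at most r sets (r odd).  Each such set is the visit pattern
of at most n^k (t)_(r-k) labelled cycles, which gives the leading term, and all
other sets contribute O(n^(k-1)) ([leq_card_embeddings_join]).

Lower bound.  In a saturated graph each nonadjacent pair x, y of distinct
vertices has a t-clique Q x y in its common neighbourhood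
([saturated_link]).  Take a tuple of m vertices, read cyclically, in which the
number c of nonadjacent consecutive pairs satisfies 0 < c <= A.  Inserting
between each of these pairs at least one vertex of its clique, A vertices in
total, closes the tuple up to a cycle of length m + A, because two adjacent
consecutive vertices need no insertion and a surplus fits into a single clique.
The inserted vertices have to be distinct and each comes from a t-clique, so
there are at least (t)_A choices; this is where the falling factorials of the
theorem come from.  Tuples that repeat a vertex or meet one of the cliques are
negligible: O(n^(m-1)) ([card_nongeneric]).  Once it is known which consecutive
pairs are adjacent, the positions of the tuple in the cycle are known, so the
tuple and the insertions can be read off from the cycle ([leq_weave]).

- If r is odd, take m = k and A = k + 1 and ask only that the first two
  vertices be nonadjacent.  By Turan's theorem in the form
  [turan_nonadjacent], at least n^k / (s - 1) tuples qualify, and there are at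
  most 2^k adjacency patterns.
- If r is even and the graph has o(n^2) edges, take m = A = k: almost all
  tuples have no adjacent consecutive pair, so a single pattern accounts for
  (1 - o(1)) n^k (t)_k labelled cycles.
- If r is even and the graph has at least n^2 / q adjacent ordered pairs, take
  m = k + 1 and A = k - 1, with tuples formed by a vertex u and k of its
  neighbours, the first two of which are nonadjacent.  The two pairs at u need
  no insertion, which leaves room for the additional entry of the tuple.
  Convexity of the k-th power gives order n^(k+1) such tuples, hence far more
  than n^k cycles.
- If r = 3, every vertex with a nonneighbour lies in a triangle, and the
  vertices without one form a clique. *)

(** * Adjacency, cliques and saturation *)

Definition adj (T : finType) (G : sgraph T) : rel T :=
  [rel x y | [set x; y] \in edges G].

Lemma adjC (T : finType) (G : sgraph T) : symmetric (adj G).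
Proof. by move=> x y; rewrite /adj /= (setUC [set x]). Qed.

Lemma adjxx (T : finType) (G : sgraph T) : irreflexive (adj G).
Proof.
move=> x /=; apply/negP => xG.
by have /'forall_implyP/(_ _ xG) := edges_card2 G; rewrite setUid cards1.
Qed.

Definition clique (T : finType) (e : rel T) (W : {set T}) : Prop :=
  {in W &, forall x y, x != y -> e x y}.

Lemma adj_mkgraph (T : finType) (E : {set {set T}}) x y :
  adj (mkgraph E) x y = ([set x; y] \in E) && (x != y).
Proof. by rewrite /adj /= inE cards2; case: (x != y). Qed.

Lemma complete_freePn (T : finType) (G : sgraph T) (s : nat) :
  ~~ is_free (complete_graph s) G <->
  exists2 W : {set T}, #|W| = s & clique (adj G) W.
Proof.
split=> [/set0Pn[S] | [W cardW cliW]].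
  rewrite inE => /andP[/andP[subE _] /existsP[f /and3P[/injectiveP inj_f _ /eqP S2]]].
  exists [set f u | u : 'I_s]; first by rewrite card_imset // card_ord.
  move=> _ _ /imsetP[i _ ->] /imsetP[j _ ->] neq_f.
  apply: (subsetP subE); rewrite -S2; apply/imsetP; exists [set i; j].
    by rewrite !inE cards2; case: (eqVneq i j) neq_f => [->|//]; rewrite eqxx.
  by rewrite imsetU1 imset_set1.
pose f : {ffun 'I_s -> T} := [ffun i => enum_val (cast_ord (esym cardW) i)].
have inj_f : injective f.
  by move=> i j; rewrite !ffunE => /enum_val_inj /cast_ord_inj.
apply/set0Pn; exists ([set f u | u : 'I_s],
  [set [set f u | u in e] | e : {set 'I_s} in edges (complete_graph s)]).
rewrite inE; apply/andP; split; last first.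
  by apply/existsP; exists f; rewrite !eqxx !andbT /=; apply/injectiveP.
apply/andP; split=> /=.
  apply/subsetP => _ /imsetP[e e2 ->]; move: e2; rewrite !inE /= => /cards2P[i [j [neq_ij ->]]].
  rewrite imsetU1 imset_set1; apply: cliW; rewrite ?ffunE ?enum_valP //.
  by rewrite (inj_eq enum_val_inj) (inj_eq (@cast_ord_inj _ _ _)).
apply/'forall_implyP => _ /imsetP[e _ ->]; apply/subsetP => _ /imsetP[u _ ->].
exact: imset_f.
Qed.

Lemma saturated_free (T : finType) (G : sgraph T) (s : nat) (W : {set T}) :
  saturated (complete_graph s) G -> #|W| = s -> ~ clique (adj G) W.
Proof.
case/andP=> freeG _ cardW cliW; move: (freeG); apply/negP.
by apply/complete_freePn; exists W.
Qed.

(** A copy of the complete graph that appears with the new edge must use both of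
its ends; the other vertices of that copy form the clique Q. *)
Lemma saturated_link (T : finType) (G : sgraph T) (s : nat) (x y : T) :
  saturated (complete_graph s.+2) G -> x != y -> ~~ adj G x y ->
  exists Q : {set T}, [/\ #|Q| = s, clique (adj G) Q
    & {in Q, forall q, adj G q x && adj G q y}].
Proof.
move=> satG neq_xy nadj; have /andP[_ /'forall_implyP/(_ [set x; y])] := satG.
rewrite cards2 neq_xy /= => /(_ nadj)/complete_freePn[W cardW cliW].
have adjE a b : adj (add_edge G [set x; y]) a b ->
    a \notin [set x; y] -> adj G a b.
  rewrite adj_mkgraph inE in_set1 => /andP[/orP[/eqP E _|//]] /negP[].
  by rewrite -E !inE eqxx.
have adjE2 a b z : adj (add_edge G [set x; y]) a b ->
    z \in [set x; y] -> z \notin W -> a \in W -> b \in W -> adj G a b.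
  rewrite adj_mkgraph inE in_set1 => /andP[/orP[/eqP E _|//]].
  by rewrite -E !inE => /orP[]/eqP-> /negPf->.
have inW z : z \in [set x; y] -> z \in W.
  move=> zxy; apply/negPn/negP => zW; apply: (saturated_free satG cardW).
  by move=> a b aW bW /(cliW _ _ aW bW)/adjE2/(_ zxy zW aW bW).
have [xW yW] : x \in W /\ y \in W by split; apply: inW; rewrite !inE eqxx ?orbT.
exists (W :\: [set x; y]); split.
- rewrite cardsD (setIidPr _) ?cards2 ?neq_xy ?cardW ?subn2 //.
  by apply/subsetP => z /inW.
- move=> a b; rewrite inE => /andP[aN aW]; rewrite inE => /andP[bN bW] ab.
  exact: adjE (cliW _ _ aW bW ab) aN.
move=> q; rewrite inE => /andP[qN qW].
rewrite !(adjE q) //; apply: cliW => //; apply: contraNneq qN => ->;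
  by rewrite !inE eqxx ?orbT.
Qed.

(** * Labelled cycles *)

(** The labelled r-cycles of G. *)
Definition embeddings (T : finType) (G : sgraph T) (r : nat) :
    {set {ffun 'I_r -> T}} :=
  [set f : {ffun 'I_r -> T} | injectiveb f & [forall i, adj G (f i) (f (ordS i))]].

Section CycleCopies.
Variables (T : finType) (G : sgraph T) (r' : nat).
Local Notation r := r'.+3.
Import GRing.Theory.
Local Open Scope ring_scope.

Lemma ordSE (i : 'I_r) : ordS i = i + 1.
Proof. by apply: val_inj; rewrite /= addn1. Qed.

Lemma one_neq_oppr1 : (1 : 'I_r) != -1.
Proof. apply/eqP => /(congr1 val) /=; by rewrite /= !(@modn_small 1) // subSS subn0 modn_small. Qed.

Lemma edges_cycle_graph :
  edges (cycle_graph r) = [set [set i; i + 1] | i : 'I_r].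
Proof.
apply/setP => e; rewrite inE; apply/andP/imsetP => [[/imsetP[i _ ->] _]|[i _ ->]].
  by exists i; rewrite ?ordSE.
rewrite cards2; split; first by apply/imsetP; exists i; rewrite ?ordSE.
by rewrite -subr_eq0 opprD addrA subrr sub0r oppr_eq0 oner_eq0.
Qed.

(** The subgraph traced by a labelled cycle, in the format of [copies]. *)
Definition cycle_image (f : {ffun 'I_r -> T}) : {set T} * {set {set T}} :=
  ([set f u | u : 'I_r], [set [set f i; f (i + 1)] | i : 'I_r]).

Lemma image_cycle_edges (f : {ffun 'I_r -> T}) :
  [set [set f u | u in e] | e : {set 'I_r} in edges (cycle_graph r)]
  = (cycle_image f).2.
Proof.
rewrite edges_cycle_graph /= -imset_comp; apply: eq_imset => i /=.
by rewrite imsetU1 imset_set1.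
Qed.

Lemma copies_cycle_graph :
  copies (cycle_graph r) G = cycle_image @: embeddings G r.
Proof.
apply/setP => S; rewrite inE; apply/andP/imsetP.
  case=> /andP[subE _] /existsP[f /and3P[inj_f /eqP S1 /eqP S2]].
  exists f; last by case: S S1 S2 {subE} => S1 S2 /= <- <-; rewrite image_cycle_edges.
  rewrite inE inj_f; apply/forallP => i.
  rewrite ordSE; apply: (subsetP subE); rewrite -S2 image_cycle_edges.
  by apply/imsetP; exists i.
case=> f; rewrite inE => /andP[inj_f /forallP adjf] ->; split; last first.
  apply/existsP; exists f; rewrite inj_f image_cycle_edges /=.
  by rewrite !eqxx.
apply/andP; split=> /=.
  by apply/subsetP => _ /imsetP[i _ ->]; have := adjf i; rewrite ordSE.
apply/'forall_implyP => _ /imsetP[i _ ->]; apply/subsetP => x.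
by rewrite !inE => /orP[]/eqP->; apply: imset_f.
Qed.

(** The symmetries of the cycle: rotations and reflections of the cyclic group
carried by ['I_r]. *)
Definition dihedral (p : 'I_r * bool) (i : 'I_r) : 'I_r :=
  p.1 + (if p.2 then i else - i).

Lemma dihedral_inj p : injective (dihedral p).
Proof. by case: p => c [] i j /addrI //= /oppr_inj. Qed.

(** Two consecutive steps cannot be opposite, since then [s] would take the same
value at distance two, which is not a full turn because the length is at least
three.  So all steps agree. *)
Lemma dihedralP (s : 'I_r -> 'I_r) : injective s ->
  (forall i, s (i + 1) - s i = 1 \/ s (i + 1) - s i = -1) ->
  exists p, s =1 dihedral p.
Proof.
move=> inj_s step.
have cst i : s (i + 1 + 1) - s (i + 1) = s (i + 1) - s i.
  have nz : s (i + 1 + 1) - s (i + 1) + (s (i + 1) - s i) != 0.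
    rewrite addrA subrK subr_eq0 (inj_eq inj_s) -addrA -{2}[i]addr0 (inj_eq (addrI i)).
    by rewrite addr_eq0 one_neq_oppr1.
  by case: (step (i + 1)) (step i) nz => -> [] ->; rewrite ?subrr ?addNr ?eqxx.
have step0 (m : nat) : s (m%:R + 1) - s m%:R = s 1 - s 0.
  by elim: m => [|m IHm]; rewrite ?add0r // -IHm -natr1 cst.
have natE (m : nat) : s m%:R = s 0 + (s 1 - s 0) *+ m.
  elim: m => [|m IHm]; first by rewrite addr0.
  by rewrite [in RHS]mulrSr addrA -IHm -(step0 m) addrC subrK natr1.
have valE (i : 'I_r) : i = (val i)%:R by rewrite [RHS]Zp_nat valZpK.
exists (s 0, s 1 - s 0 == 1) => i; rewrite /dihedral {1}[i]valE natE /=.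
congr (_ + _); have := step 0; rewrite add0r => -[] ->.
  by rewrite eqxx; rewrite [RHS]valE.
by rewrite eq_sym (negPf one_neq_oppr1) mulNrn; rewrite [in RHS](valE i).
Qed.

Lemma set2_eq (U : finType) (a b c d : U) :
  [set a; b] = [set c; d] -> (a = c /\ b = d) \/ (a = d /\ b = c).
Proof.
move=> E.
have : a \in [set c; d] by rewrite -E !inE eqxx.
have : b \in [set c; d] by rewrite -E !inE eqxx orbT.
have : c \in [set a; b] by rewrite E !inE eqxx.
have : d \in [set a; b] by rewrite E !inE eqxx orbT.
rewrite !inE => /orP[]/eqP ? /orP[]/eqP ? /orP[]/eqP ? /orP[]/eqP ?; subst; auto.
Qed.

Lemma cycle_image_dihedral (f : {ffun 'I_r -> T}) p :
  cycle_image [ffun i => f (dihedral p i)] = cycle_image f.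
Proof.
have surj j : exists i, dihedral p i = j.
  by have /codomP[i ->] := inj_card_onto (@dihedral_inj p) (leqnn _) j; exists i.
congr pair; apply/setP => x.
  apply/imsetP/imsetP => -[i _ ->]; first by rewrite ffunE; exists (dihedral p i).
  by have [j <-] := surj i; exists j => //; rewrite ffunE.
case: p surj => c [] surj; apply/imsetP/imsetP => -[i _ ->].
- by exists (c + i); rewrite // !ffunE /dihedral /= addrA.
- by exists (i - c); rewrite // !ffunE /dihedral /= (addrA c (i - c)) (addrC c) subrK.
- exists (c - (i + 1)); rewrite // !ffunE /dihedral /= opprD addrA subrK.
  by rewrite setUC.
exists (c - (i + 1)); rewrite // !ffunE /dihedral /= [in RHS]setUC.
congr [set f _; f _]; last by rewrite subKr.
by rewrite (opprD i 1) (addrA c (- i)) subrK subKr.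
Qed.

Lemma embeddings_dihedral (f : {ffun 'I_r -> T}) p :
  f \in embeddings G r -> [ffun i => f (dihedral p i)] \in embeddings G r.
Proof.
rewrite !inE => /andP[/injectiveP inj_f /forallP adjf].
apply/andP; split.
  by apply/injectiveP => i j; rewrite !ffunE => /inj_f /dihedral_inj.
apply/forallP => i; rewrite !ffunE ordSE; case: p => c [] /=; rewrite /dihedral /=.
  by rewrite addrA -ordSE; apply: adjf.
have := adjf (c - (i + 1)); by rewrite ordSE adjC (opprD i 1) addrA subrK.
Qed.

(** If two labelled cycles trace the same subgraph, the relabelling that leads from
one to the other moves consecutive positions to consecutive positions. *)
Lemma cycle_image_inj (f g : {ffun 'I_r -> T}) :
  injective f -> injective g -> cycle_image g = cycle_image f ->
  exists p, g = [ffun i => f (dihedral p i)].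
Proof.
move=> inj_f inj_g [E1 E2].
have gf i : exists j, g i == f j.
  have : g i \in [set f u | u : 'I_r] by rewrite -E1 imset_f.
  by case/imsetP => j _ ->; exists j.
pose s i := xchoose (gf i).
have sE i : g i = f (s i) by apply/eqP; apply: (xchooseP (gf i)).
have inj_s : injective s by move=> i j Eij; apply: inj_g; rewrite !sE Eij.
have [|p sp] := dihedralP inj_s; last first.
  by exists p; apply/ffunP => i; rewrite ffunE sE sp.
move=> i; have : [set g i; g (i + 1)] \in (cycle_image f).2.
  by rewrite /= -E2; apply/imsetP; exists i.
case/imsetP => j _; rewrite !sE => /set2_eq[] [/inj_f-> /inj_f->].
  by left; rewrite addrC addKr.
by right; rewrite opprD addrA subrr sub0r.
Qed.

Lemma card_embeddings_aux : #|embeddings G r| = (r * 2 * ncopies (cycle_graph r) G)%N.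
Proof.
rewrite /ncopies copies_cycle_graph -sum1_card.
rewrite (partition_big_imset cycle_image) /= [LHS](_ : _ = \sum_(S in cycle_image @: embeddings G r) (r * 2))%N.
  by rewrite sum_nat_const mulnC.
apply: eq_bigr => _ /imsetP[f f_emb ->].
pose h p := [ffun i => f (dihedral p i)].
have inj_f : injective f by move: f_emb; rewrite inE => /andP[/injectiveP].
have inj_h : injective h.
  move=> [c b] [c' b'] /ffunP E; have E0 := E 0; have E1 := E 1.
  move: E0 E1; rewrite !ffunE => /inj_f + /inj_f.
  rewrite /dihedral /= !oppr0 !if_same !addr0 => <- /addrI.
  by case: b {E}; case: b' => //= /eqP; rewrite ?(negPf one_neq_oppr1) // eq_sym (negPf one_neq_oppr1).
rewrite sum1dep_card.
transitivity #|h @: [set: 'I_r * bool]|.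
  congr #|pred_of_set _|; apply/setP => g; rewrite inE; apply/andP/imsetP.
    case=> g_emb /eqP Eg; have inj_g : injective g.
      by move: g_emb; rewrite inE => /andP[/injectiveP].
    by have [p ->] := cycle_image_inj inj_f inj_g Eg; exists p.
  by case=> p _ ->; rewrite cycle_image_dihedral embeddings_dihedral.
by rewrite card_imset // cardsT card_prod card_ord card_bool.
Qed.

End CycleCopies.

Lemma card_embeddings (T : finType) (G : sgraph T) (r : nat) : 3 <= r ->
  #|embeddings G r| = r * 2 * ncopies (cycle_graph r) G.
Proof. by case: r => [|[|[|r]]] // _; apply: card_embeddings_aux. Qed.

(** A second presentation of labelled cycles, suited to the construction of cycles
by concatenation of paths. *)
Definition cycle_tuples (V : finType) (e : rel V) (r : nat) : {set r.-tuple V} :=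
  [set p : r.-tuple V | uniq p && cycle e p].

Lemma leq_card_cycle_tuples (V : finType) (G : sgraph V) (r : nat) :
  #|cycle_tuples (adj G) r| <= #|embeddings G r|.
Proof.
pose h (p : r.-tuple V) := [ffun i => tnth p i].
have inj_h : injective h.
  by move=> p q /ffunP E; apply: eq_from_tnth => i; have := E i; rewrite !ffunE.
rewrite -(card_imset _ inj_h); apply/subset_leq_card/subsetP => _ /imsetP[p + ->].
rewrite !inE => /andP[up cp]; apply/andP; split.
  apply/injectiveP => i j; rewrite !ffunE => /eqP; have x0 := tnth p i.
  by rewrite !(tnth_nth x0) nth_uniq ?size_tuple // => /eqP/val_inj.
apply/forallP => i; rewrite !ffunE.
case: r p {h inj_h} up cp i => [|r] p up cp i; first by case: i.
case/tupleP: p up cp => x p _ /= /(pathP x)/(_ i).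
have si : i < size (rcons p x) by rewrite size_rcons size_tuple ltn_ord.
move=> /(_ si) {si}.
rewrite !(tnth_nth x) /= -rcons_cons nth_rcons /= size_tuple ltn_ord.
rewrite nth_rcons size_tuple; case: ltngtP => [lt_ir|gt_ir|->]; last by rewrite modnn.
  by rewrite modn_small.
by have := ltn_ord i; lia.
Qed.

(** * The join of a clique and an empty graph *)

Definition clique_join_empty (t n : nat) : sgraph 'I_n :=
  mkgraph [set e : {set 'I_n} | [exists i in e, i < t]].

Lemma adj_join (t n : nat) (i j : 'I_n) :
  adj (clique_join_empty t n) i j = ((i < t) || (j < t)) && (i != j).
Proof.
rewrite adj_mkgraph inE; congr (_ && _); apply/existsP/orP.
  by case=> x /andP[]; rewrite !inE => /orP[]/eqP->; auto.
by case=> H; [exists i | exists j]; rewrite !inE eqxx ?orbT.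
Qed.

Lemma card_core (t n : nat) : t <= n -> #|[set i : 'I_n | i < t]| = t.
Proof.
move=> le_tn; transitivity #|[set widen_ord le_tn i | i : 'I_t]|.
  congr #|pred_of_set _|; apply/setP => i; rewrite inE; apply/idP/imsetP.
    by move=> it; exists (Ordinal it) => //; apply: val_inj.
  by case=> j _ ->; apply: (ltn_ord j).
rewrite card_imset ?card_ord // => i j /(congr1 val) /= E; exact: val_inj.
Qed.

(** A clique has at most one vertex outside the t universal ones, and two outside
vertices together with these t make a clique as soon as they are joined. *)
Lemma join_saturated (t n : nat) :
  saturated (complete_graph t.+2) (clique_join_empty t n).
Proof.
apply/andP; split; last first.
  apply/'forall_implyP => e /andP[/cards2P[x [y [neq_xy ->]]] nadj].
  apply/complete_freePn; exists ([set i : 'I_n | i < t] :|: [set x; y]).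
    have /norP[] : ~~ ((x < t) || (y < t)).
      by move: nadj; rewrite -[_ \in _]/(adj _ x y) adj_join neq_xy andbT.
    rewrite -!leqNgt => tx ty; rewrite cardsU cards2 neq_xy card_core.
      rewrite (_ : _ :&: _ = set0) ?cards0 ?subn0 ?addn2 //.
      by apply/setP => i; rewrite !inE; case: eqP => [->|_]; [|case: eqP => [->|_]];
        rewrite ?andbF // leqNgt in tx ty *; rewrite ltnNge ?tx ?ty // ?andbF; lia.
    by apply: leq_trans tx (ltnW (ltn_ord x)).
  move=> a b aW bW neq_ab; rewrite adj_mkgraph neq_ab andbT inE.
  rewrite -[X in _ || X]/(adj (clique_join_empty t n) a b) adj_join neq_ab andbT.
  move: aW bW neq_ab; rewrite !inE => /orP[-> _|aW /orP[->|bW]]; rewrite ?orbT //.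
  move: aW bW => /orP[]/eqP-> /orP[]/eqP->; rewrite ?eqxx // => _.
  by rewrite setUC eqxx.
apply/negPn/negP => /complete_freePn[W cardW cliW].
have tn : t <= n.
  by have := subset_leqif_cards (subsetT W); move=> -[]; rewrite cardW cardsT card_ord; lia.
have : #|W :\: [set i : 'I_n | i < t]| <= 1.
  apply/card_le1_eqP => b a; rewrite !inE => /andP[/negPf bN bW] /andP[/negPf aN aW].
  by apply/eqP/negPn/negP => /(cliW _ _ aW bW); rewrite adj_join aN bN.
have : #|W :&: [set i : 'I_n | i < t]| <= t.
  by rewrite -[leqRHS](card_core tn) subset_leq_card // subsetIr.
move=> leI leD; have := leq_add leI leD.
by rewrite cardsID cardW addn1 ltnn.
Qed.

(** * Cyclic index sets without consecutive elements *)

(** Stable sets of the cycle graph. *)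
Definition cyclic_stable r (J : {set 'I_r}) := [forall i in J, ordS i \notin J].

Lemma cyclic_ind r (P : 'I_r -> Prop) z :
  P z -> (forall i, P i -> P (ordS i)) -> forall i, P i.
Proof.
move=> Pz PS i; case: r P z Pz PS i => [|r] P z Pz PS i; first by case: i.
have iterP j : P (iter j (@ordS r.+1) z) by elim: j => //= j /PS.
have val_iter j : iter j (@ordS r.+1) z = (z + j) %% r.+1 :> nat.
  elim: j => [|j IHj]; first by rewrite addn0 modn_small.
  by rewrite iterS /= IHj -addn1 modnDml addn1 addnS.
rewrite (_ : i = iter (i + r.+1 - z) (@ordS r.+1) z) //; apply: val_inj => /=.
rewrite val_iter subnKC ?modnDr ?modn_small //.
by rewrite (leq_trans (ltnW (ltn_ord z))) // leq_addl.
Qed.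

Section Stable.
Variable r : nat.
Implicit Types J : {set 'I_r}.

Lemma cyclic_stable_disjoint J : cyclic_stable J -> [disjoint J & [set ordS i | i in J]].
Proof.
move/'forall_implyP => stJ; rewrite disjoint_sym disjoint_subset.
by apply/subsetP => _ /imsetP[i iJ ->]; apply: stJ.
Qed.

Lemma card_cyclic_stableU J : cyclic_stable J -> #|J :|: [set ordS i | i in J]| = #|J|.*2.
Proof.
move/cyclic_stable_disjoint => disJ.
by rewrite cardsU disjoint_setI0 // cards0 subn0 card_imset ?addnn //; apply: ordS_inj.
Qed.

Lemma leq_cyclic_stable J : cyclic_stable J -> #|J|.*2 <= r.
Proof. by move/card_cyclic_stableU <-; rewrite -[leqRHS]card_ord max_card. Qed.

Lemma mem_ordS J i : cyclic_stable J ->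
  ordS i \in J :|: [set ordS i | i in J] -> (ordS i \in J) = (i \notin J).
Proof.
move=> stJ; rewrite inE => /orP[iJ|/imsetP[j jJ /ordS_inj->]].
  by rewrite iJ; symmetry; apply: contraTN iJ; move/'forall_implyP: stJ; apply.
by rewrite jJ; apply/negbTE; move/'forall_implyP: stJ; apply.
Qed.

(** Where [J] and its shift cover, membership of [ordS i] is the negation of
membership of [i], and elsewhere it fails.  So a stable set is determined by
the part that it covers with its shift, together with one membership. *)
Lemma cyclic_stable_eq J1 J2 z : cyclic_stable J1 -> cyclic_stable J2 ->
  (z \in J1) = (z \in J2) ->
  (forall i, i \in J1 :|: [set ordS i | i in J1] -> i \in J2 :|: [set ordS i | i in J2]) ->
  (forall i, i \notin J1 :|: [set ordS i | i in J1] -> i \notin J2 :|: [set ordS i | i in J2]) ->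
  J1 = J2.
Proof.
move=> st1 st2 Ez sub12 sub21; apply/setP; apply: (cyclic_ind Ez) => i Ei.
have [i1|i1] := boolP (ordS i \in J1 :|: [set ordS i | i in J1]).
  by rewrite (mem_ordS st1 i1) (mem_ordS st2 (sub12 _ i1)) Ei.
have := sub21 _ i1; move: i1; rewrite !inE !negb_or.
by move=> /andP[/negPf-> _] /andP[/negPf-> _].
Qed.

(** Here [J] and its shift cover everything, so the membership of one index
determines [J]. *)
Lemma card_cyclic_stable_even k : r = k.*2 ->
  #|[set J : {set 'I_r} | cyclic_stable J & #|J| == k]| <= 2.
Proof.
move=> def_r; have [r0|r_gt0] := posnP r.
  apply: leq_trans (max_card _) _; rewrite -cardsT -powersetT card_powerset cardsT.
  by rewrite card_ord r0.
pose z : 'I_r := Ordinal r_gt0.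
have full J : cyclic_stable J -> #|J| == k -> J :|: [set ordS i | i in J] = setT.
  move=> stJ /eqP cJ; apply/eqP; rewrite eqEcard subsetT cardsT card_ord.
  by rewrite card_cyclic_stableU // cJ -def_r /=.
rewrite -card_bool -(@card_in_imset _ _ (fun J => z \in J)) ?max_card //.
move=> J1 J2; rewrite !inE => /andP[st1 c1] /andP[st2 c2] Ez.
by apply: (cyclic_stable_eq st1 st2 Ez) => i; rewrite !full // inE.
Qed.

(** Here [J] and its shift leave out exactly one index, which determines [J]. *)
Lemma card_cyclic_stable_odd k : r = k.*2.+1 ->
  #|[set J : {set 'I_r} | cyclic_stable J & #|J| == k]| <= r.
Proof.
move=> def_r.
have hole J : cyclic_stable J -> #|J| == k ->
    exists z, ~: (J :|: [set ordS i | i in J]) = [set z].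
  move=> stJ /eqP cJ; apply/cards1P; rewrite -(eqn_add2l #|J :|: [set ordS i | i in J]|).
  by rewrite cardsC card_ord card_cyclic_stableU // cJ addn1 -def_r.
rewrite -[leqRHS]card_ord; apply: (@leq_trans #|[set [set z] | z : 'I_r]|); last exact: leq_imset_card.
rewrite -(@card_in_imset _ _ (fun J => ~: (J :|: [set ordS i | i in J]))).
  apply/subset_leq_card/subsetP => _ /imsetP[J + ->]; rewrite inE => /andP[stJ cJ].
  by have [z ->] := hole J stJ cJ; apply: imset_f.
move=> J1 J2; rewrite !inE => /andP[st1 c1] /andP[st2 c2] /setC_inj EU.
have [z Ez] := hole J1 st1 c1.
have /setP/(_ z) := Ez; rewrite !inE eqxx negb_or => /andP[/negPf z1 _].
have /setP/(_ z) : ~: (J2 :|: [set ordS i | i in J2]) = [set z] by rewrite -EU.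
rewrite !inE eqxx negb_or => /andP[/negPf z2 _].
by apply: (cyclic_stable_eq st1 st2 (z := z)); rewrite ?z1 ?z2 // => i; rewrite EU.
Qed.

End Stable.

(** * Labelled cycles in the join *)

Section Upper.
Variables (t n r : nat).
Hypothesis le_tn : t <= n.
Local Notation G0 := (clique_join_empty t n).

(** The positions at which a labelled cycle of the join visits the empty part. *)
Definition outside (f : {ffun 'I_r -> 'I_n}) : {set 'I_r} := [set i | t <= f i].

Lemma outside_stable f : f \in embeddings G0 r -> cyclic_stable (outside f).
Proof.
rewrite inE => /andP[_ /forallP adjf]; apply/'forall_implyP => i.
by have := adjf i; rewrite adj_join !inE -ltnNge (leqNgt t (f i)) => /andP[/orP[->|->]].
Qed.

(** The visits to the empty part are bounded by arbitrary functions, those to the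
clique by injective ones. *)
Lemma card_embeddings_outside J :
  #|[set f in embeddings G0 r | outside f == J]| <= n ^ #|J| * t ^_ (r - #|J|).
Proof.
pose I := {i | i \in J}; pose O := {i | i \notin J}.
pose core := [set i : 'I_n | i < t].
pose inj_core := [set g : {ffun O -> 'I_n} in ffun_on (mem core) | injectiveb g].
have -> : n ^ #|J| * t ^_ (r - #|J|) = #|setX [set: {ffun I -> 'I_n}] inj_core|.
  rewrite cardsX cardsT card_ffun card_ord card_inj_ffuns_on card_core //.
  rewrite !card_sig; congr (_ * _ ^_ _).
  by rewrite -[X in X - _]card_ord -(cardC J) addKn.
pose h (f : {ffun 'I_r -> 'I_n}) :=
  ([ffun x : I => f (val x)], [ffun x : O => f (val x)]).
rewrite -(@card_in_imset _ _ h); last first.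
  move=> f g _ _ [/ffunP E1 /ffunP E2]; apply/ffunP => i.
  have [iJ|iJ] := boolP (i \in J).
    by have := E1 (Sub i iJ); rewrite !ffunE.
  by have := E2 (Sub i iJ); rewrite !ffunE.
apply/subset_leq_card/subsetP => _ /imsetP[f + ->].
rewrite !inE /= => /andP[/andP[/injectiveP inj_f _] /eqP defJ].
apply/andP; split.
  apply/ffun_onP => x; rewrite ffunE inE ltnNge; have := valP x.
  by move: defJ => /setP/(_ (val x)); rewrite inE => ->.
by apply/injectiveP => x y; rewrite !ffunE => /inj_f /val_inj.
Qed.

Lemma leq_card_embeddings_join k : 0 < n -> (forall J : {set 'I_r}, cyclic_stable J -> #|J| <= k.+1) ->
  #|embeddings G0 r| <=
  #|[set J : {set 'I_r} | cyclic_stable J & #|J| == k.+1]| * t ^_ (r - k.+1) * n ^ k.+1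
  + (\sum_(J : {set 'I_r}) t ^_ (r - #|J|)) * n ^ k.
Proof.
move=> n_gt0 leJ.
have -> : #|embeddings G0 r| = \sum_(J | cyclic_stable J) #|[set f in embeddings G0 r | outside f == J]|.
  rewrite -sum1_card (partition_big outside (@cyclic_stable r)) => [|f]; last exact: outside_stable.
  by apply: eq_bigr => J _; rewrite sum1dep_card.
apply: (@leq_trans (\sum_(J : {set 'I_r} | cyclic_stable J) n ^ #|J| * t ^_ (r - #|J|))).
  by apply: leq_sum => J _; apply: card_embeddings_outside.
rewrite (bigID (fun J : {set 'I_r} => #|J| == k.+1)) /=; apply: leq_add.
  rewrite -mulnA -sum_nat_const big_mkcond [leqRHS]big_mkcond.
  apply: leq_sum => J _; rewrite inE; case: ifP => // /andP[_ /eqP->].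
  by rewrite mulnC.
rewrite big_distrl /= big_mkcond; apply: leq_sum => J _; case: ifP => // /andP[/leJ le neq].
by rewrite mulnC leq_mul2l leq_pexp2l ?orbT // -ltnS ltn_neqAle neq.
Qed.

End Upper.

(** * Counting tuples *)

Lemma card_dep_pairs (I J : finType) (P : pred I) (R : I -> pred J) :
  #|[set p : I * J | P p.1 && R p.1 p.2]| = \sum_(i | P i) #|[set j | R i j]|.
Proof.
rewrite -sum1dep_card -(pair_big_dep P R (fun _ _ => 1)) /=.
by apply: eq_bigr => i _; rewrite sum1dep_card.
Qed.

Lemma card_tupleS (V : finType) m (P : pred (seq V)) :
  #|[set t : m.+1.-tuple V | P t]| = \sum_x #|[set t : m.-tuple V | P (x :: t)]|.
Proof.
rewrite -sum1dep_card (partition_big (@thead m V) xpredT) //=.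
apply: eq_bigr => x _; rewrite sum1dep_card.
have inj_cons : injective (fun t : m.-tuple V => [tuple of x :: t]).
  by move=> t1 t2 /(congr1 val) [] /val_inj.
rewrite -(card_imset _ inj_cons); congr #|pred_of_set _|; apply/setP => t.
rewrite inE; apply/andP/imsetP => [[Pt /eqP tx]|[t' + ->]].
  exists [tuple of behead t]; last by rewrite -tx -tuple_eta.
  by rewrite inE -tx -/(thead t) /=; rewrite [t]tuple_eta in Pt.
by rewrite inE => Pt; rewrite theadE eqxx.
Qed.

Definition tuple_update (V : eqType) m (v : m.-tuple V) (l : 'I_m) (c : V) : m.-tuple V :=
  [tuple if i == l then c else tnth v i | i < m].

Lemma tnth_tuple_update (V : eqType) m (v : m.-tuple V) l c i :
  tnth (tuple_update v l c) i = if i == l then c else tnth v i.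
Proof. by rewrite tnth_mktuple. Qed.

Lemma leq_card_cover (I T : finType) (A : {set T}) (F : I -> {set T}) :
  (forall x, x \in A -> exists i, x \in F i) -> #|A| <= \sum_i #|F i|.
Proof.
move=> cov; apply: (@leq_trans #|\bigcup_i F i|).
  by apply/subset_leq_card/subsetP => x /cov[i xFi]; apply/bigcupP; exists i.
by elim/big_ind2: _ => // [|m1 S1 m2 S2 le1 le2]; rewrite ?cards0 //
  (leq_trans (leq_card_setU _ _)) // leq_add.
Qed.

(** Overwriting coordinate [l] of a bad tuple by an arbitrary vertex loses no more
than the position of the old value in [B], which is still known because
coordinates [i] and [j] are untouched.  This avoids any explicit product
decomposition of the tuples. *)
Lemma card_tuple_coord (V : finType) m (B : V -> V -> {set V}) (c : nat) (i j l : 'I_m) :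
  l != i -> l != j -> (forall x y, #|B x y| <= c.+1) ->
  #|[set v : m.-tuple V | tnth v l \in B (tnth v i) (tnth v j)]| * #|V|
  <= c.+1 * #|V| ^ m.
Proof.
move=> li lj leB; set Bad := [set v | _].
pose idx (v : m.-tuple V) : 'I_c.+1 :=
  inord (index (tnth v l) (enum (B (tnth v i) (tnth v j)))).
pose f (p : m.-tuple V * V) := (tuple_update p.1 l p.2, idx p.1).
have injf : {in setX Bad [set: V] &, injective f}.
  move=> [v x] [w y]; rewrite !inE /= !andbT => vB wB E.
  have Ei k : tnth (tuple_update v l x) k = tnth (tuple_update w l y) k by have /= -> := congr1 fst E.
  have := congr1 (val \o snd) E; rewrite /= {E}.
  have E' k : k != l -> tnth v k = tnth w k.
    by move=> /negPf kl; have := Ei k; rewrite !tnth_tuple_update kl.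
  have xy : x = y by have := Ei l; rewrite !tnth_tuple_update eqxx.
  have Eli := E' i; have Elj := E' j; rewrite eq_sym in Eli; rewrite eq_sym in Elj.
  have lt_idx u : tnth u l \in B (tnth u i) (tnth u j) ->
      index (tnth u l) (enum (B (tnth u i) (tnth u j))) < c.+1.
    by move=> uB; apply: leq_trans (leB (tnth u i) (tnth u j)); rewrite cardE index_mem mem_enum.
  rewrite !inordK ?lt_idx // (Eli li) (Elj lj) => Eidx.
  rewrite (Eli li) (Elj lj) -mem_enum in vB; rewrite -mem_enum in wB.
  have Evw : tnth v l = tnth w l.
    by rewrite -(nth_index x vB) Eidx nth_index.
  congr pair => //; apply: eq_from_tnth => k.
  by have [->|/E'] := eqVneq k l.
have -> : c.+1 * #|V| ^ m = #|{: m.-tuple V * 'I_c.+1}|.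
  by rewrite card_prod card_tuple card_ord mulnC.
by rewrite -(cardsT V) -cardsX -(card_in_imset injf) max_card.
Qed.

(** Exchanging coordinates [i] and [j] of a tuple with an external pair is an
involution. *)
Lemma card_tuple_pair (V : finType) m (P : rel V) (i j : 'I_m) : i != j ->
  #|[set v : m.-tuple V | P (tnth v i) (tnth v j)]| * #|V| ^ 2
  = #|[set p : V * V | P p.1 p.2]| * #|V| ^ m.
Proof.
move=> neq_ij.
pose f (p : m.-tuple V * (V * V)) :=
  (tuple_update (tuple_update p.1 i p.2.1) j p.2.2, (tnth p.1 i, tnth p.1 j)).
have fK : involutive f.
  move=> [v [x y]]; rewrite /f /=; congr (_, (_, _)).
  - apply: eq_from_tnth => k; rewrite !tnth_tuple_update.
    by have [->|] := eqVneq k j; last by have [->|] := eqVneq k i.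
  - by rewrite !tnth_tuple_update (negPf neq_ij) eqxx.
  by rewrite !tnth_tuple_update eqxx.
have -> : #|V| ^ 2 = #|[set: V * V]| by rewrite cardsT card_prod mulnn.
have -> : #|V| ^ m = #|[set: m.-tuple V]| by rewrite cardsT card_tuple.
rewrite [RHS]mulnC -!cardsX.
rewrite -(card_imset _ (inv_inj fK)); congr #|pred_of_set _|.
apply/setP => -[v [x y]]; rewrite !inE /=; apply/imsetP/idP.
  case=> -[w [x' y']]; rewrite !inE /= andbT => Pw [_ -> ->] //.
rewrite /= => Pxy; exists (f (v, (x, y))); last by rewrite fK.
by rewrite !inE /= andbT !tnth_tuple_update (negPf neq_ij) !eqxx.
Qed.

Lemma card_all_tuples (V : finType) j (P : pred V) : #|[set v : j.-tuple V | all P v]| = #|P| ^ j.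
Proof.
elim: j => [|j IHj].
  transitivity #|[set: 0.-tuple V]|; last by rewrite cardsT card_tuple.
  by apply: eq_card => v; rewrite !inE tuple0.
rewrite (card_tupleS _ (fun v => all P v)) expnS -IHj -sum_nat_const big_mkcond [RHS]big_mkcond /=.
apply: eq_bigr => x _; rewrite unfold_in; case: (P x) => /=; first by apply: eq_card => v; rewrite !inE.
by apply: eq_card0 => v; rewrite !inE.
Qed.

(** * Closing a tuple of vertices up to a cycle *)

Section Weave.
Variables (V : finType) (e : rel V) (Q : V -> V -> {set V}) (t : nat).
Hypothesis e_sym : symmetric e.
Hypothesis Q_clique : forall x y, x != y -> ~~ e x y -> clique e (Q x y).
Hypothesis Q_adj : forall x y, x != y -> ~~ e x y ->
  {in Q x y, forall q, e q x && e q y}.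
Hypothesis Q_card : forall x y, x != y -> ~~ e x y -> t <= #|Q x y|.

(** Insertions between the nonadjacent neighbours of a walk.  The surplus [a] is
spent at the first nonadjacent pair, so that the total number of insertions can
be prescribed whenever there is such a pair. *)
Fixpoint weave a x ys W :=
  if ys is y :: ys' then
    if e x y then y :: weave a y ys' W
    else take a.+1 W ++ y :: weave 0 y ys' (drop a.+1 W)
  else [::].

(** The cliques from which the successive entries of [W] are taken in [weave]. *)
Fixpoint links a x ys :=
  if ys is y :: ys' then
    if e x y then links a y ys' else nseq a.+1 (Q x y) ++ links 0 y ys'
  else [::].

(** The mask that tells the vertices of [ys] from the inserted ones in [weave]; it
depends only on the adjacencies [bs] along the walk. *)
Fixpoint layout a bs :=
  if bs is b :: bs' then
    if b then true :: layout a bs' else nseq a.+1 false ++ true :: layout 0 bs'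
  else [::].

Definition picks (W : seq V) (Qs : seq {set V}) :=
  all2 (fun w (S : {set V}) => w \in S) W Qs.

Lemma size_picks W Qs : picks W Qs -> size W = size Qs.
Proof. by rewrite /picks all2E => /andP[/eqP]. Qed.

Lemma picks_nseq n S W Qs : picks W (nseq n S ++ Qs) ->
  [/\ size (take n W) = n, all (mem S) (take n W) & picks (drop n W) Qs].
Proof.
elim: n W => [|n IHn] [|w W] //=; rewrite ?take0 // => /andP[wS /IHn[-> -> ->]].
by rewrite wS.
Qed.

Lemma clique_path (C : {set V}) w W y : clique e C -> {in C, forall c, e c y} ->
  uniq (w :: W) -> w \in C -> all (mem C) W -> path e w (rcons W y).
Proof.
move=> cliC Cy; elim: W w => [|w' W IHW] w /=; first by move=> _ /Cy->.
move=> /andP[wN uW] wC /andP[w'C WC]; rewrite IHW // andbT; apply: cliC => //.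
by apply: contraNneq wN => ->; rewrite inE eqxx.
Qed.

Lemma weave_path a x ys W : path [rel u v | u != v] x ys ->
  uniq W -> picks W (links a x ys) -> path e x (weave a x ys W).
Proof.
elim: ys a x W => [|y ys IHys] a x W //= /andP[neq_xy neqs] uW.
case: ifPn => [exy|nexy]; first by rewrite /= exy; apply: IHys.
move=> /(@picks_nseq a.+1)[].
case: W uW => //= w W /andP[wN uW] _ /andP[wQ WQ] /IHys path_rest.
have /andP[ewx ewy] := Q_adj neq_xy nexy wQ.
rewrite e_sym ewx /= -cat_rcons cat_path last_rcons path_rest ?drop_uniq //.
rewrite andbT; apply: (@clique_path (Q x y)) => //.
- exact: Q_clique.
- by move=> c /(Q_adj neq_xy nexy)/andP[].
by rewrite /= take_uniq // andbT; apply: contra wN => /mem_take.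
Qed.

Lemma last_weave a x ys W : last x (weave a x ys W) = last x ys.
Proof.
elim: ys a x W => [|y ys IHys] a x W //=; case: ifP => _ /=; first exact: IHys.
by rewrite last_cat /= IHys.
Qed.

(** In particular the walk repeats no vertex as soon as [ys ++ W] does not. *)
Lemma weave_perm a x ys W : size W = size (links a x ys) ->
  perm_eq (weave a x ys W) (ys ++ W).
Proof.
elim: ys a x W => [|y ys IHys] a x W /=; first by move/size0nil->.
case: ifP => _; first by move=> /IHys; rewrite /= perm_cons.
move=> sW; rewrite -cat_rcons -[in X in perm_eq _ X](cat_take_drop a.+1 W).
rewrite (perm_trans (y := (y :: take a.+1 W) ++ (ys ++ drop a.+1 W))) //.
  apply: perm_cat; first by rewrite perm_rcons.
  by apply: IHys; rewrite size_drop sW /= size_cat size_nseq; lia.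
by rewrite /= perm_cons perm_catCA.
Qed.

(** With [layout] known, both ingredients can be recovered from the walk.  The
injectivity in [leq_weave] rests on this. *)
Lemma weave_mask a x ys W : size W = size (links a x ys) ->
  mask (layout a (pairmap e x ys)) (weave a x ys W) = ys /\
  mask (map negb (layout a (pairmap e x ys))) (weave a x ys W) = W.
Proof.
elim: ys a x W => [|y ys IHys] a x W; first by move/size0nil->.
rewrite /=; case: ifP => _; first by move=> /IHys[/= -> ->].
rewrite -[_ :: _ ++ links _ _ _]/(nseq a.+1 (Q x y) ++ _) size_cat size_nseq => sW.
rewrite -[_ :: _ ++ _]/(nseq a.+1 false ++ _).
have [sT sD] : size (take a.+1 W) = a.+1 /\
    size (drop a.+1 W) = size (links 0 y ys).
  by rewrite size_drop size_takel sW; [split; lia | lia].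
have [E1 E2] := IHys _ _ _ sD.
rewrite map_cat map_nseq !mask_cat ?size_nseq // mask_false mask_true ?sT //.
by rewrite /= E1 E2 cat_take_drop.
Qed.

Lemma size_links a x ys :
  size (links a x ys) =
  if all id (pairmap e x ys) then 0 else a + count negb (pairmap e x ys).
Proof.
elim: ys a x => [|y ys IHys] a x //=; case: (e x y) => /=; first exact: IHys.
rewrite size_cat size_nseq IHys; case: ifP => [all_e|_]; last by lia.
rewrite (_ : count _ _ = 0); first by lia.
by apply/eqP; rewrite eqn0Ngt -has_count -all_predC; apply: sub_all all_e => -[].
Qed.

Lemma links_sub a x ys S : path [rel u v | u != v] x ys -> S \in links a x ys ->
  exists u v, [/\ u \in x :: ys, v \in x :: ys, u != v, ~~ e u v & S = Q u v].
Proof.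
elim: ys a x => [|y ys IHys] a x //= /andP[neq_xy neqs].
have step a' : S \in links a' y ys -> exists u v,
    [/\ u \in x :: y :: ys, v \in x :: y :: ys, u != v, ~~ e u v & S = Q u v].
  move=> /(IHys _ _ neqs)[u [v [uy vy *]]].
  by exists u, v; rewrite in_cons uy orbT in_cons vy orbT.
case: ifPn => [_|nexy]; first exact: step.
rewrite -[_ :: _]/(nseq a.+1 (Q x y) ++ _) mem_cat => /orP[|]; last exact: step.
by rewrite mem_nseq => /eqP->; exists x, y; rewrite !inE !eqxx orbT.
Qed.

(** The next entry has to avoid [X] and the entries already chosen, which excludes
at most one more element of its clique at each step. *)
Lemma card_picks (Qs : seq {set V}) (X : {set V}) A : size Qs = A ->
  (forall S, S \in Qs -> t <= #|S|) ->
  (t - #|X|) ^_ A <= #|[set W : A.-tuple V |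
     [&& picks W Qs, uniq W & all (predC (mem X)) W]]|.
Proof.
elim: Qs X A => [|S Qs IHQs] X A <- geQ.
  rewrite ffactn0; apply/card_gt0P; exists [tuple].
  by rewrite inE.
rewrite (card_tupleS _ (fun W => [&& picks W (S :: Qs), uniq W & all (predC (mem X)) W])).
rewrite ffactnS; apply: (@leq_trans (\sum_(x in S :\: X) (t - #|X|).-1 ^_ (size Qs))).
  rewrite sum_nat_const leq_mul2r; apply/orP; right.
  rewrite cardsD; apply: leq_trans (leq_sub2l _ (subset_leq_card (subsetIr S X))).
  by rewrite leq_sub2r // geQ // inE eqxx.
rewrite big_mkcond /=; apply: leq_sum => x _; case: ifP => //; rewrite inE => /andP[xX xS].
have -> : (t - #|X|).-1 = t - #|x |: X| by rewrite cardsU1 xX; lia.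
apply: leq_trans (IHQs _ _ erefl _) _; first by move=> S' S'Q; rewrite geQ // inE S'Q orbT.
apply/subset_leq_card/subsetP => W; rewrite !inE /= => /and3P[pW uW /allP WX].
rewrite /picks /= xS -/(picks W Qs) pW uW xX /= andbT.
apply/andP; split; first by apply/negP => /WX; rewrite /= !inE eqxx.
by apply/allP => w /WX /=; rewrite !inE negb_or => /andP[].
Qed.

(** Insertions taken from the cliques of a generic tuple cannot collide with the
tuple itself. *)
Definition generic (v : seq V) :=
  uniq v && [forall x in v, forall y in v, (x != y) && ~~ e x y ==>
    [disjoint Q x y & v]].

Definition pattern (v : seq V) :=
  if v is x :: _ then pairmap e x (rot 1 v) else [::].

Lemma rot1_neq (x y : V) s : uniq (x :: y :: s) ->
  path [rel u v | u != v] x (rot 1 (x :: y :: s)).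
Proof.
rewrite rot1_cons => /= /andP[xN uys].
rewrite (_ : x != y) /=; last by apply: contraNneq xN => ->; rewrite inE eqxx.
rewrite rcons_path /=; apply/andP; split; last first.
  by apply: contraNneq xN => <-; rewrite mem_last.
elim: s y {xN} uys => [|z s IHs] y //= /andP[yN uzs]; rewrite IHs // andbT.
by apply: contraNneq yN => ->; rewrite inE eqxx.
Qed.

Lemma size_pattern v : size (pattern v) = size v.
Proof. by case: v => //= x v; rewrite size_pairmap size_rot. Qed.

(** A labelled cycle arises from at most one tuple with pattern [b] and at most one
choice of insertions, by [weave_mask]. *)
Lemma leq_weave m A (b : seq bool) : 0 < count negb b <= A ->
  #|[set v : m.+2.-tuple V | generic v && (pattern v == b)]| * t ^_ A
  <= #|cycle_tuples e (m.+2 + A)|.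
Proof.
case/andP=> b_gt0 b_leA.
(* The surplus that [weave] spends at the first nonadjacent pair. *)
pose a := A - count negb b.
pose lk (v : seq V) := if v is x :: _ then links a x (rot 1 v) else [::].
pose wv (v W : seq V) := if v is x :: _ then weave a x (rot 1 v) W else [::].
pose P (v : m.+2.-tuple V) := generic v && (pattern v == b).
pose K (v : m.+2.-tuple V) (W : A.-tuple V) :=
  [&& picks W (lk v), uniq W & all (predC (mem v)) W].
have lkP (v : m.+2.-tuple V) : P v ->
    size (lk v) = A /\ forall S, S \in lk v -> t <= #|S| /\ [disjoint S & v].
  case/andP => + /eqP; case/tupleP: v => x v; case/tupleP: v => y v.
  case/andP=> uv /'forall_implyP genv patb.
  have neqs := rot1_neq uv; split.
    rewrite -[lk _]/(links a x (rot 1 [:: x, y & v])) size_links.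
    rewrite -[pairmap _ _ _]/(pattern [:: x, y & v]) patb.
    rewrite ifF; first by rewrite /a; lia.
    by apply: contraTF b_gt0 => /allP b1; rewrite -has_count -all_predC; apply/allP => z /b1 /= ->.
  move=> S /(links_sub neqs)[u [w [uv' wv' neq_uw neuw ->]]]; split; first exact: Q_card.
  have inv z : z \in x :: rot 1 [:: x, y & v] -> z \in [:: x, y & v].
    by rewrite in_cons mem_rot => /orP[/eqP->|//]; rewrite inE eqxx.
  have /'forall_implyP/(_ _ (inv _ wv'))/implyP := genv _ (inv _ uv').
  by apply; rewrite neq_uw.
pose D := [set p : m.+2.-tuple V * A.-tuple V | P p.1 && K p.1 p.2].
have leD : #|[set v | P v]| * t ^_ A <= #|D|.
  rewrite card_dep_pairs -sum_nat_const big_mkcond [leqRHS]big_mkcond /=.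
  apply: leq_sum => v _; rewrite inE; case: ifP => // Pv.
  have [slk lkv] := lkP v Pv; rewrite -[t]subn0 -(@cards0 V).
  apply: leq_trans (card_picks _ slk _) _; first by move=> S /lkv[].
  apply/subset_leq_card/subsetP => W; rewrite !inE => /and3P[pW uW _].
  rewrite /K pW uW /=.
  have := pW; rewrite /picks all2E => /andP[/eqP sWl /allP zip_in].
  apply/allP => w wW /=; pose i := index w W.
  have iW : i < size W by rewrite index_mem.
  have /zip_in : (nth w W i, nth set0 (lk v) i) \in zip W (lk v).
    by rewrite -nth_zip // mem_nth // size_zip -sWl minnn.
  rewrite /= nth_index //; apply: contraTN => wv'.
  have /lkv[_ dis] : nth set0 (lk v) i \in lk v by rewrite mem_nth // -sWl.
  by rewrite (disjointFl dis).
apply: leq_trans leD _.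
pose phi (p : m.+2.-tuple V * A.-tuple V) : (m.+2 + A).-tuple V :=
  [tuple nth (thead p.1) (wv p.1 p.2) i | i < m.+2 + A].
have sW p : p \in D -> size p.2 = size (lk p.1).
  by rewrite inE => /andP[_ /and3P[/size_picks]].
have permp p : p \in D -> perm_eq (wv p.1 p.2) (p.1 ++ p.2).
  move=> pD; move: (sW _ pD); case: p {pD} => v W; case/tupleP: v => x v /= sWl.
  rewrite (perm_trans (weave_perm sWl)) //.
  by rewrite -[x :: _ ++ _]/((x :: v) ++ W) perm_cat2r perm_rot.
have phiE p : p \in D -> phi p = wv p.1 p.2 :> seq V.
  move=> pD; have swv : size (wv p.1 p.2) = m.+2 + A.
    by rewrite (perm_size (permp _ pD)) size_cat !size_tuple.
  apply: (@eq_from_nth _ (thead p.1)); rewrite size_tuple ?swv // => i ltir.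
  by rewrite -[i]/(nat_of_ord (Ordinal ltir)) -tnth_nth tnth_mktuple.
have inj_phi : {in D &, injective phi}.
  move=> p q pD qD /(congr1 val) /=; rewrite (phiE p pD) (phiE q qD).
  have := sW _ qD; have := sW _ pD; move: pD qD; rewrite !inE => /andP[/andP[_ +] _] /andP[/andP[_ +] _].
  move=> /eqP bp /eqP bq; case: p q bp bq => [v W] [v' W'] /= bp bq sp sq E.
  suff [E1 E2] : rot 1 v = rot 1 v' /\ W = W' :> seq V.
    by congr pair; apply: val_inj; rewrite //; apply: rot_inj E1.
  case/tupleP: v bp sp E => x v /= bp sp E.
  case/tupleP: v' bq sq E => x' v' /= bq sq E.
  have [] := weave_mask sp; have [] := weave_mask sq.
  by rewrite bp bq E => -> -> -> ->.
rewrite -(card_in_imset inj_phi); apply/subset_leq_card/subsetP => _ /imsetP[p pD ->].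
rewrite inE (phiE _ pD) (perm_uniq (permp _ pD)).
have := sW _ pD; move: pD; rewrite inE; case: p => v W /=.
move=> /andP[/andP[/andP[uv _] _] /and3P[pW uW /allP WN]] sWl.
rewrite cat_uniq uv uW andbT /= -all_predC.
apply/andP; split; first by apply/allP => w /WN.
case/tupleP: v uv {sWl} pW {WN} => x v; case/tupleP: v => y v uv pW.
rewrite -[wv _ _]/(weave a x (rot 1 [:: x, y & v]) W) (cycle_path x) last_weave.
rewrite [in last _ _]rot1_cons last_rcons.
by apply: weave_path => //; apply: rot1_neq.
Qed.

(** Summation of [leq_weave] over the [2 ^ m.+2] possible patterns. *)
Lemma leq_weave_sum m A (X : {set m.+2.-tuple V}) :
  (forall v, v \in X -> generic v && (0 < count negb (pattern v) <= A)) ->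
  #|X| * t ^_ A <= 2 ^ m.+2 * #|cycle_tuples e (m.+2 + A)|.
Proof.
move=> XP; have sp (v : m.+2.-tuple V) : size (pattern v) == m.+2.
  by rewrite size_pattern size_tuple.
rewrite -sum1_card (partition_big (fun v => Tuple (sp v)) xpredT) //= big_distrl /=.
rewrite -[2]card_bool -[X in _ ^ X](size_tuple (nseq_tuple m.+2 true)).
rewrite size_tuple -card_tuple -sum_nat_const; apply: leq_sum => b _.
rewrite sum1dep_card.
have [|/set0Pn[v0]] := eqVneq [set v in X | Tuple (sp v) == b] set0.
  by move=> ->; rewrite cards0.
rewrite inE => /andP[/XP/andP[_ cnt] /eqP Eb].
apply: leq_trans (@leq_weave m A b _); last by rewrite -Eb.
rewrite leq_mul2r; apply/orP; right; apply/subset_leq_card/subsetP => v.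
by rewrite !inE => /andP[/XP/andP[-> _] /eqP <-] /=.
Qed.

End Weave.

(** * Nonadjacent pairs in graphs with small cliques *)

Section Turan.
Variables (V : finType) (e : rel V).
Hypothesis e_sym : symmetric e.
Hypothesis e_irr : irreflexive e.

Definition nonadjacent_pairs (S : {set V}) : {set V * V} :=
  [set p : V * V | [&& p.1 \in S, p.2 \in S & ~~ e p.1 p.2]].

Lemma card_nonadjacent_pairs S :
  #|nonadjacent_pairs S| = \sum_(x in S) #|S :\: [set y | e x y]|.
Proof.
rewrite /nonadjacent_pairs (card_dep_pairs (mem S) (fun x y => (y \in S) && ~~ e x y)).
by apply: eq_bigr => x _; apply: eq_card => y; rewrite !inE andbC.
Qed.

(** Counting the diagonal pairs lets the inequality hold without an error term.
For a vertex [v] of largest degree in [S] with neighbourhood [N], every vertex of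
[S] has at least [#|S :\: N|] nonneighbours in [S], itself included; this is used
for the vertices outside [N], and the induction hypothesis inside [N]. *)
Lemma turan_nonadjacent t (S : {set V}) :
  (forall W : {set V}, W \subset S -> clique e W -> #|W| <= t) ->
  #|S| ^ 2 <= t * #|nonadjacent_pairs S|.
Proof.
elim: t S => [|t IHt] S smallW.
  have [->|/set0Pn[x xS]] := eqVneq S set0; first by rewrite cards0.
  have cli1 : clique e [set x].
    by move=> a b; rewrite !inE => /eqP-> /eqP->; rewrite eqxx.
  by have := smallW [set x]; rewrite cards1 sub1set xS => /(_ isT cli1).
have [->|/set0Pn[x0 x0S]] := eqVneq S set0; first by rewrite cards0.
pose N x := S :&: [set y | e x y].
case: (@arg_maxnP _ x0 (mem S) (fun x => #|N x|) x0S) => v.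
rewrite -[_ v]/(v \in S) => vS maxv.
have NvS : N v \subset S by apply: subsetIl.
have /IHt leN (W : {set V}) : W \subset N v -> clique e W -> #|W| <= t.
  move=> WN cliW.
  have vW : v \notin W.
    by apply/negP => /(subsetP WN); rewrite !inE e_irr andbF.
  have := smallW (v |: W); rewrite cardsU1 vW; apply.
    by rewrite subUset sub1set vS (subset_trans WN).
  have eW w : w \in W -> e v w by move=> /(subsetP WN); rewrite !inE => /andP[].
  move=> a b; rewrite !inE => /orP[/eqP->|aW] /orP[/eqP->|bW]; rewrite ?eqxx // => ab.
  - exact: eW.
  - by rewrite e_sym eW.
  exact: cliW.
have cardS : #|S| = #|S :\: N v| + #|N v|.
  by rewrite -(cardsID (N v) S) (setIidPr NvS) addnC.
have := leN; rewrite card_nonadjacent_pairs => leN'.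
rewrite card_nonadjacent_pairs (big_setID (N v)) /= (setIidPr NvS).
have le1 : \sum_(x in N v) #|N v :\: [set y | e x y]| <= \sum_(x in N v) #|S :\: [set y | e x y]|.
  by apply: leq_sum => x _; apply/subset_leq_card/setSD.
have le2 : #|S :\: N v| * #|S :\: N v| <= \sum_(x in S :\: N v) #|S :\: [set y | e x y]|.
  rewrite -sum_nat_const; apply: leq_sum => x; rewrite inE => /andP[_ xS].
  rewrite !cardsD (setIidPr NvS) leq_sub2l //.
  exact: (maxv x xS).
move: leN' le1 le2; rewrite cardS.
move: #|S :\: N v| #|N v| => a b; set Y := \sum_(x in N v) _; set Z := \sum_(x in N v) _.
set X := \sum_(x in S :\: N v) _ => leN' le1 le2.
have {}leN' : b ^ 2 <= t * Z by apply: leq_trans leN' _; rewrite leq_mul2l le1 orbT.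
(* It remains to see that (a + b)^2 <= (t + 1)(a^2 + Z) when b^2 <= t Z; for
   t > 0 this is the inequality 2 (t a) b <= (t a)^2 + b^2. *)
case: t {IHt smallW leN} leN' => [|t] leN'.
  have -> : b = 0 by move: leN'; rewrite mul0n leqn0 expn_eq0 => /andP[/eqP].
  by rewrite addn0 mul1n -mulnn (leq_trans le2) ?leq_addl.
rewrite -mulnn -(leq_pmul2l (ltn0Sn t)).
have : b * b <= t.+1 * Z by rewrite mulnn.
have := leq_mul (leqnn (t.+1 * t.+2)) le2.
have : 2 * (t.+1 * a) * b <= t.+1 * a * (t.+1 * a) + b * b.
  by have [+ _] := nat_Cauchy (t.+1 * a) b; rewrite -!mulnn mulnA.
nia.
Qed.

End Turan.

(** * Many labelled cycles in graphs with linked nonadjacent pairs *)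

Section LowerBounds.
Variables (V : finType) (e : rel V) (Q : V -> V -> {set V}) (t : nat).
Hypothesis e_sym : symmetric e.
Hypothesis e_irr : irreflexive e.
Hypothesis Q_clique : forall x y, x != y -> ~~ e x y -> clique e (Q x y).
Hypothesis Q_adj : forall x y, x != y -> ~~ e x y ->
  {in Q x y, forall q, e q x && e q y}.
Hypothesis Q_card : forall x y, x != y -> ~~ e x y -> #|Q x y| = t.
Hypothesis small_clique : forall W : {set V}, clique e W -> #|W| <= t.+1.

Let Q_card_ge x y : x != y -> ~~ e x y -> t <= #|Q x y|.
Proof. by move=> neq_xy /(Q_card neq_xy)->. Qed.

Local Notation n := #|V|.
Local Notation cyc := (cycle_tuples e).

(** Each way of being nongeneric puts one coordinate into a set of at most [t.+1]
vertices that is determined by other coordinates. *)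
Lemma card_nongeneric m :
  #|[set v : m.-tuple V | ~~ generic e Q v]| * n <= m ^ 3 * t.+1 * n ^ m.
Proof.
pose B x y := if (x != y) && ~~ e x y then x |: Q x y else [set x].
pose F (p : 'I_m * 'I_m * 'I_m) : {set m.-tuple V} :=
  if (p.2 != p.1.1) && (p.2 != p.1.2)
  then [set v | tnth v p.2 \in B (tnth v p.1.1) (tnth v p.1.2)] else set0.
have leB x y : #|B x y| <= t.+1.
  rewrite /B; case: ifPn => [/andP[neq_xy nexy]|_]; last by rewrite cards1.
  by rewrite cardsU1 Q_card //; case: (x \notin _); lia.
apply: (@leq_trans ((\sum_p #|F p|) * n)).
  rewrite leq_mul2r; apply/orP; right; apply: leq_card_cover => v; rewrite inE.
  rewrite negb_and => /orP[|].
    move=> not_uniq; have x0 : V by case: (tval v) not_uniq.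
    have [i [j [lt_ij lt_jm E]]] := uniqPn x0 not_uniq.
    rewrite size_tuple in lt_jm.
    exists (Ordinal (ltn_trans lt_ij lt_jm), Ordinal (ltn_trans lt_ij lt_jm), Ordinal lt_jm).
    rewrite /F /= -val_eqE /= gtn_eqF //= inE /B eqxx /= inE.
    by rewrite !(tnth_nth x0) /= E.
  case/forall_inPn => x /tnthP[i ->] /forall_inPn[_ /tnthP[j ->]].
  rewrite negb_imply => /andP[nadj /pred0Pn[z /= /andP[zQ /tnthP[l El]]]].
  have [neq_ij nexy] := andP nadj; have := Q_adj neq_ij nexy zQ.
  rewrite {z}El in zQ * => /andP[eli elj].
  exists (i, j, l); rewrite /F /=.
  rewrite (_ : (l != i) && (l != j)).
    by rewrite inE /B nadj inE zQ orbT.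
  by apply/andP; split; [move: eli | move: elj]; apply: contraTneq => ->; rewrite e_irr.
rewrite big_distrl /=; apply: (@leq_trans (\sum_(p : 'I_m * 'I_m * 'I_m) t.+1 * n ^ m)).
  apply: leq_sum => -[[i j] l] _; rewrite /F /=; case: ifP => [/andP[li lj]|_].
    exact: card_tuple_coord.
  by rewrite cards0.
by rewrite sum_nat_const !card_prod !card_ord !expnS expn0 muln1 !mulnA.
Qed.

Lemma nth_pattern v i : i < size v -> forall x0 b0,
  nth b0 (pattern e v) i = e (nth x0 v i) (nth x0 v (i.+1 %% size v)).
Proof.
case: v => // x v lt_iv x0 b0; rewrite /pattern (nth_pairmap x0) ?size_rot //.
rewrite rot1_cons nth_rcons; move: lt_iv; rewrite /= ltnS leq_eqVlt => /orP[/eqP->|lt_iv].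
  rewrite ltnn eqxx modnn; congr e.
  by rewrite -rcons_cons nth_rcons /= ltnSn.
rewrite lt_iv modn_small // /= -rcons_cons nth_rcons /= ltnS ltnW //.
Qed.

(** The tuples used here have length [k] and start with a nonadjacent pair; up to
[k.+1] insertions are allowed, so no condition on the other pairs is needed. *)
Lemma leq_odd_cycle_tuples m (k := m.+2) :
  n ^ k.+1 * t ^_ k.+1 <=
  t.+1 * 2 ^ k * n * #|cyc (k + k.+1)| + t.+1 ^ 2 * k ^ 3 * t ^_ k.+1 * n ^ k.
Proof.
have [V0|V_gt0] := posnP n; first by rewrite V0 exp0n // mul0n.
pose Y := [set v : k.-tuple V | ~~ e (tnth v (inord 0)) (tnth v (inord 1))].
pose N := [set v : k.-tuple V | ~~ generic e Q v].
pose X := Y :&: [set v : k.-tuple V | generic e Q v].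
have cardX : #|X| * t ^_ k.+1 <= 2 ^ k * #|cyc (k + k.+1)|.
  apply: (@leq_weave_sum _ e Q t) => // v; rewrite !inE => /andP[Yv ->] /=.
  rewrite (leq_trans (count_size _ _)) ?size_pattern ?size_tuple // andbT.
  move: Yv; case/tupleP: v => x v; case/tupleP: v => y v.
  by rewrite !(tnth_nth x) /= !inordK //= => /negPf->.
have cardY : n ^ k <= t.+1 * #|Y|.
  rewrite -(leq_pmul2r (_ : 0 < n ^ 2)) ?expn_gt0 ?V_gt0 //.
  rewrite -mulnA (card_tuple_pair (fun x y => ~~ e x y)) -?val_eqE /= ?inordK //.
  have := @turan_nonadjacent _ e e_sym e_irr t.+1 [set: V] (fun W _ => @small_clique W).
  rewrite cardsT (eq_card (B := [set p | ~~ e p.1 p.2])); last by move=> p; rewrite !inE.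
  by move=> le_turan; rewrite mulnA [leqLHS]mulnC leq_mul2r le_turan orbT.
have leY : #|Y| <= #|X| + #|N|.
  rewrite -(cardsID [set v : k.-tuple V | generic e Q v] Y) leq_add2l.
  by apply/subset_leq_card/subsetP => v; rewrite !inE => /andP[].
have ng : #|N| * n <= _ := card_nongeneric k.
move: cardX cardY leY ng; rewrite (expnS n k).
move: #|X| #|Y| #|N| #|cyc _| (t ^_ k.+1) (n ^ k) (2 ^ k) (k ^ 3) => X' Y' N' C T P K2 K3.
move=> cX cY leY ng.
have cY' : P <= t.+1 * (X' + N') by apply: leq_trans cY _; rewrite leq_mul2l leY orbT.
have h1 : n * P * T <= n * (t.+1 * (X' + N')) * T.
  by rewrite leq_mul2r leq_mul2l cY' !orbT.
apply: leq_trans h1 _.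
have h2 := leq_mul (leqnn (t.+1 * n)) cX.
have h3 := leq_mul (leqnn (t.+1 * T)) ng.
rewrite -mulnn; lia.
Qed.

Definition edge_pairs := [set p : V * V | e p.1 p.2].

(** All consecutive pairs are asked to be nonadjacent, so only one pattern occurs
and nothing is lost to a sum over patterns. *)
Lemma leq_even_cycle_tuples_sparse m q (k := m.+2) : #|edge_pairs| * q <= n ^ 2 ->
  q * n ^ k.+1 * t ^_ k <=
  n * q * #|cyc (k + k)| + (q * k ^ 3 * t.+1 + k * n) * n ^ k * t ^_ k.
Proof.
move=> sparse.
have [V0|V_gt0] := posnP n; first by rewrite V0 exp0n // muln0 mul0n.
pose X := [set v : k.-tuple V | generic e Q v && (pattern e v == nseq k false)].
have cardX : #|X| * t ^_ k <= #|cyc (k + k)|.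
  by apply: (@leq_weave _ e Q t) => //; rewrite count_nseq /= mul1n.
pose E (i : 'I_k) := [set v : k.-tuple V | e (tnth v i) (tnth v (ordS i))].
pose N := [set v : k.-tuple V | ~~ generic e Q v].
have cardE i : #|E i| * q <= n ^ k.
  rewrite -(leq_pmul2r (_ : 0 < n ^ 2)) ?expn_gt0 ?V_gt0 //.
  rewrite mulnAC card_tuple_pair.
    by rewrite mulnAC mulnC leq_mul2l sparse orbT.
  rewrite -val_eqE /=; have := ltn_ord i; rewrite leq_eqVlt => /orP[/eqP E1|lt_ik].
    rewrite E1 modnn; have : i.+1 = m.+2 by []. by case: (val i).
  by rewrite modn_small // neq_ltn ltnSn.
have cov : n ^ k <= #|X| + (#|N| + \sum_i #|E i|).
  rewrite -card_tuple -cardsT -(cardsID X) setTI leq_add2l setTD.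
  rewrite -(cardsID N) leq_add ?subset_leq_card ?subsetIr //.
  apply: leq_card_cover => v; rewrite !inE negb_and negbK => /andP[gv].
  rewrite gv /= => /eqP pat.
  have [/existsP[i Ei]|nE] := boolP [exists i, v \in E i]; first by exists i.
  case: pat; rewrite -[RHS]/(nseq k false) -[k in RHS](size_tuple v) -(size_pattern e).
  apply/all_pred1P/(all_nthP false) => i; rewrite size_pattern => lt_iv.
  have lt_ik : i < k by rewrite -(size_tuple v).
  move: nE; rewrite negb_exists => /forallP/(_ (Ordinal lt_ik)).
  rewrite inE !(tnth_nth (thead v)) /= => /negPf Ei.
  by rewrite (nth_pattern lt_iv (thead v)) size_tuple Ei.
have sumE : (\sum_i #|E i|) * q <= k * n ^ k.
  rewrite big_distrl /= -[X in X * _]card_ord -sum_nat_const.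
  exact: leq_sum.
have ng : #|N| * n <= _ := card_nongeneric k.
move: cardX cov sumE ng; rewrite (expnS n k).
move: #|X| #|N| (\sum_i _) #|cyc _| (t ^_ k) (n ^ k) (k ^ 3) => X' N' S C T P K3.
move=> cX cov sE ng.
have h1 : q * (n * P) * T <= q * (n * (X' + (N' + S))) * T.
  by rewrite leq_mul2r !leq_mul2l cov !orbT.
apply: leq_trans h1 _.
have h2 := leq_mul (leqnn (q * n)) cX.
have h3 := leq_mul (leqnn (q * T)) ng.
have h4 := leq_mul (leqnn (n * T)) sE.
lia.
Qed.

(** [turan_nonadjacent] inside each neighbourhood; the remaining [m] leaves of the
star are free. *)
Lemma card_nonadjacent_stars m :
  \sum_u #|[set x | e u x]| ^ m.+2 <=
  t.+1 * #|[set v : m.+3.-tuple V | if val v is [:: u, x, y & _]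
     then all (e u) (behead v) && ~~ e x y else false]|.
Proof.
rewrite (card_tupleS _ (fun v => if v is [:: u, x, y & _]
     then all (e u) (behead v) && ~~ e x y else false)) big_distrr /=.
apply: leq_sum => u _; set N := [set x | e u x].
rewrite (card_tupleS _ (fun v => if v is [:: x, y & _]
     then all (e u) v && ~~ e x y else false)).
have -> : \sum_x #|[set v : m.+1.-tuple V | if x :: v is [:: x, y & _]
     then all (e u) (x :: v) && ~~ e x y else false]| =
   #|nonadjacent_pairs e N| * #|N| ^ m.
  transitivity (\sum_x \sum_y if (x, y) \in nonadjacent_pairs e N then #|N| ^ m else 0).
    apply: eq_bigr => x _; rewrite (card_tupleS _ (fun v => if x :: v is [:: x, y & _]
      then all (e u) (x :: v) && ~~ e x y else false)).
    apply: eq_bigr => y _; rewrite !inE /=; case: ifP => [/and3P[ux uy /negPf nxy]|nP].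
      rewrite ux uy nxy -[#|N|](eq_card (A := e u)) => [|w]; last by rewrite !inE.
      by rewrite -card_all_tuples; apply: eq_card => w; rewrite !inE andbT.
    apply: eq_card0 => w; rewrite !inE; move: nP.
    by case: (e u x); case: (e u y) => //= ->; rewrite andbF.
  by rewrite pair_bigA /= -sum_nat_const [RHS]big_mkcond; apply: eq_bigr => -[].
have := @turan_nonadjacent _ e e_sym e_irr t.+1 N (fun W _ => @small_clique W).
by move=> le_turan; rewrite mulnA -addn2 addnC expnD leq_mul2r le_turan orbT.
Qed.

(** A substitute for the convexity of powers: summed over the degrees, it bounds
their power sum from below by the number of edges. *)
Lemma expn_tangent a b m : b ^ m.+1 * a <= a ^ m.+2 + b ^ m.+2.
Proof.
have [le_ba|lt_ab] := leqP b a.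
  by rewrite (leq_trans _ (leq_addr _ _)) // [leqRHS]expnSr leq_mul2r leq_exp2r ?le_ba ?orbT.
by rewrite (leq_trans _ (leq_addl _ _)) // [leqRHS]expnSr leq_mul2l ltnW ?orbT.
Qed.

(** In a tuple made of a vertex and [k] of its neighbours two consecutive pairs are
adjacent.  So [k - 1] insertions suffice, and the tuple can have one entry more
than in the sparse case. *)
Lemma leq_even_cycle_tuples_dense m q (k := m.+2) : m < t -> n ^ 2 <= #|edge_pairs| * q ->
  n ^ k.+1 <= (2 * q) ^ k * t.+1
              * (2 ^ k.+1 * #|cyc (k + k)| + k.+1 ^ 3 * t.+1 * n ^ k).
Proof.
move=> lt_mt dense.
have [V0|V_gt0] := posnP n; first by rewrite V0 exp0n.
have cardE : #|edge_pairs| = \sum_u #|[set x | e u x]|.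
  by rewrite /edge_pairs (card_dep_pairs xpredT e).
have power_mean : n ^ k.+1 <= (2 * q) ^ k * \sum_u #|[set x | e u x]| ^ k.
  (* [expn_tangent] at 2 q d and n, summed over the degrees d: the edges give at
     least 2 n^(k+1), and the terms n^k take away half of this. *)
  rewrite -(leq_add2r (n ^ k.+1)) addnn -mul2n.
  apply: (@leq_trans (n ^ m.+1 * (2 * q * #|edge_pairs|))).
    rewrite -mulnA mulnCA leq_mul2l /= (_ : k.+1 = m.+1 + 2); last by rewrite addn2.
    rewrite expnD leq_mul2l; by rewrite [q * _]mulnC dense orbT.
  rewrite cardE !big_distrr /= (expnS n k) -sum_nat_const -big_split /=.
  apply: leq_sum => u _; rewrite -expnMn; exact: expn_tangent.
pose Y := [set v : m.+3.-tuple V | if val v is [:: u, x, y & _]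
     then all (e u) (behead v) && ~~ e x y else false].
pose N := [set v : m.+3.-tuple V | ~~ generic e Q v].
pose X := Y :&: [set v : m.+3.-tuple V | generic e Q v].
have cardX : #|X| * t ^_ m.+1 <= 2 ^ m.+3 * #|cyc (k + k)|.
  have -> : k + k = m.+3 + m.+1 by rewrite /k; lia.
  apply: (@leq_weave_sum _ e Q t) => // v; rewrite !inE => /andP[+ ->] /=.
  case/tupleP: v => u v; case/tupleP: v => x v; case/tupleP: v => y w.
  rewrite /pattern [X in rot 1 X]/= rot1_cons /= => /andP[/and3P[-> uy all_w] /negPf->] /=; rewrite add0n add1n ltnS.
  have uyw : all (e u) (y :: w) by rewrite /= uy.
  rewrite -cats1 pairmap_cat count_cat /= e_sym (allP uyw) ?mem_last // !addn0.
  by rewrite (leq_trans (count_size _ _)) // size_pairmap size_tuple.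
have leY : #|Y| <= #|X| + #|N|.
  rewrite -(cardsID [set v : m.+3.-tuple V | generic e Q v] Y) leq_add2l.
  by apply/subset_leq_card/subsetP => v; rewrite !inE => /andP[].
have leN : #|N| <= k.+1 ^ 3 * t.+1 * n ^ k.
  rewrite -(leq_pmul2r V_gt0) -[leqRHS]mulnA -expnSr; exact: card_nongeneric.
apply: leq_trans power_mean _; rewrite -mulnA leq_mul2l; apply/orP; right.
apply: leq_trans (card_nonadjacent_stars m) _; rewrite leq_mul2l /=.
apply: leq_trans leY _; rewrite leq_add //; apply: leq_trans cardX.
by rewrite leq_pmulr // ffact_gt0.
Qed.

(** The vertices adjacent to all others form a clique; any other vertex forms a
triangle with two elements of one of its linking cliques. *)
Lemma leq_triangle_tuples : 1 < t -> n <= t.+1 + #|cyc 3|.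
Proof.
move=> t_gt1; pose U := [set x | [forall y, (x != y) ==> e x y]].
rewrite -(cardsC U) leq_add //.
  by apply: small_clique => x y; rewrite inE => /forallP/(_ y)/implyP + _.
pose h (p : 3.-tuple V) := thead p.
apply: (@leq_trans #|h @: cyc 3|); last exact: leq_imset_card.
apply/subset_leq_card/subsetP => x; rewrite !inE negb_forall => /existsP[y].
rewrite negb_imply => /andP[neq_xy nexy].
have : 1 < #|Q x y| by rewrite Q_card.
case/card_gt1P => w [z [wQ zQ neq_wz]].
have /andP[ewx _] := Q_adj neq_xy nexy wQ; have /andP[ezx _] := Q_adj neq_xy nexy zQ.
have ewz := Q_clique neq_xy nexy wQ zQ neq_wz.
apply/imsetP; exists [tuple x; w; z]; last by rewrite /h theadE.
rewrite !inE /= !inE ewz ezx (e_sym x) ewx /= !andbT neq_wz andbT negb_or.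
by apply/andP; split; apply/eqP => E; move: ewx ezx; rewrite -?E e_irr.
Qed.

End LowerBounds.

(** * Copies of cycles in saturated graphs *)

Section SaturatedLowerBounds.
Variables (V : finType) (G : sgraph V) (t : nat).
Hypothesis satG : saturated (complete_graph t.+2) G.
Local Notation n := #|V|.
Local Notation N r := (ncopies (cycle_graph r) G).

Lemma saturated_links : exists Q : V -> V -> {set V},
  forall x y, x != y -> ~~ adj G x y ->
  [/\ #|Q x y| = t, clique (adj G) (Q x y)
    & {in Q x y, forall q, adj G q x && adj G q y}].
Proof.
have ex (p : V * V) : exists Q : {set V}, p.1 != p.2 -> ~~ adj G p.1 p.2 ->
  [/\ #|Q| = t, clique (adj G) Q & {in Q, forall q, adj G q p.1 && adj G q p.2}].
  have [->|neq] := eqVneq p.1 p.2; first by exists set0; rewrite ?eqxx.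
  have [a|na] := boolP (adj G p.1 p.2); first by exists set0.
  by have [Q HQ] := saturated_link satG neq na; exists Q.
have [Q HQ] := fin_all_exists ex.
by exists (fun x y => Q (x, y)) => x y; apply: (HQ (x, y)).
Qed.

Lemma saturated_small_clique (W : {set V}) : clique (adj G) W -> #|W| <= t.+1.
Proof.
move=> cliW; rewrite leqNgt; apply/negP => lt_tW.
have [W' sW' cardW'] : exists2 W' : {set V}, W' \subset W & #|W'| = t.+2.
  have /card_geqP[s [us sz sW]] := lt_tW.
  exists [set x in s]; last by rewrite cardsE (card_uniqP us).
  by apply/subsetP => x; rewrite inE => /sW.
apply: (saturated_free satG cardW') => x y /(subsetP sW') xW /(subsetP sW') yW.
exact: cliW.
Qed.

Lemma leq_odd_copies m (k := m.+2) (r := k + k.+1) :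
  n ^ k.+1 * t ^_ k.+1 <=
  t.+1 * 2 ^ k * n * (r * 2 * N r) + t.+1 ^ 2 * k ^ 3 * t ^_ k.+1 * n ^ k.
Proof.
have [Q HQ] := saturated_links.
apply: (@leq_trans (t.+1 * 2 ^ k * n * #|cycle_tuples (adj G) r|
    + t.+1 ^ 2 * k ^ 3 * t ^_ k.+1 * n ^ k)); last first.
  rewrite leq_add2r leq_mul2l -card_embeddings ?leq_card_cycle_tuples ?orbT //.
  by rewrite /r /k; lia.
apply: (@leq_odd_cycle_tuples V (adj G) Q t (@adjC _ G) (@adjxx _ G)).
- by move=> x y neq nadj; have [] := HQ x y neq nadj.
- by move=> x y neq nadj; have [] := HQ x y neq nadj.
- by move=> x y neq nadj; have [] := HQ x y neq nadj.
exact: saturated_small_clique.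
Qed.

Lemma leq_triangle_copies : 1 < t -> n <= t.+1 + 3 * 2 * N 3.
Proof.
have [Q HQ] := saturated_links => t_gt1.
apply: (@leq_trans (t.+1 + #|cycle_tuples (adj G) 3|)); last first.
  by rewrite leq_add2l -card_embeddings // leq_card_cycle_tuples.
apply: (@leq_triangle_tuples V (adj G) Q t (@adjC _ G) (@adjxx _ G)) => //.
- by move=> x y neq nadj; have [] := HQ x y neq nadj.
- by move=> x y neq nadj; have [] := HQ x y neq nadj.
- by move=> x y neq nadj; have [] := HQ x y neq nadj.
exact: saturated_small_clique.
Qed.

(** The threshold between the sparse and the dense case is at [n ^ 2] over [q]
adjacent ordered pairs.  In the dense case [n] is large enough for the term of
order [n ^ k.+1] to dominate. *)
Lemma leq_even_copies m q (k := m.+2) (T := t ^_ k)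
    (c1 := (2 * q) ^ k * t.+1 * 2 ^ k.+1)
    (c2 := (2 * q) ^ k * t.+1 * (k.+1 ^ 3 * t.+1)) :
  m < t -> 0 < q -> q * k ^ 3 * t.+1 <= n -> c2 + c1 * T <= n -> 0 < n ->
  q * (n ^ k * T) <= q * ((k + k) * 2 * N (k + k)) + k.+1 * (n ^ k * T).
Proof.
move=> lt_mt q_gt0 nq nc n_gt0; have [Q HQ] := saturated_links.
apply: (@leq_trans (q * #|cycle_tuples (adj G) (k + k)| + k.+1 * (n ^ k * T))); last first.
  rewrite leq_add2r leq_mul2l -card_embeddings ?leq_card_cycle_tuples ?orbT //.
  by rewrite /k; lia.
have h1 x y : x != y -> ~~ adj G x y -> clique (adj G) (Q x y).
  by move=> neq nadj; have [] := HQ x y neq nadj.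
have h2 x y : x != y -> ~~ adj G x y ->
    {in Q x y, forall q, adj G q x && adj G q y}.
  by move=> neq nadj; have [] := HQ x y neq nadj.
have h3 x y : x != y -> ~~ adj G x y -> #|Q x y| = t.
  by move=> neq nadj; have [] := HQ x y neq nadj.
have [sparse|/ltnW dense] := leqP (#|edge_pairs (adj G)| * q) (n ^ 2).
  have := leq_even_cycle_tuples_sparse (@adjC _ G) (@adjxx _ G) h1 h2 h3 m sparse.
  rewrite -/k -/T (expnS n k); move: #|cycle_tuples _ _| (n ^ k) => C P le_sp.
  rewrite -(leq_pmul2l n_gt0).
  apply: leq_trans (leq_trans le_sp _); first by rewrite !mulnA (mulnC n q).
  rewrite -!mulnA mulnDr leq_add2l.
  have := leq_mul nq (leqnn (P * T)); lia.
have := leq_even_cycle_tuples_dense (@adjC _ G) (@adjxx _ G) h1 h2 h3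
  saturated_small_clique lt_mt dense.
rewrite -/k (expnS n k).
have c1_gt0 : 0 < c1 by rewrite /c1 muln_gt0 muln_gt0 !expn_gt0 muln_gt0 q_gt0.
move: c1_gt0 nc {nq lt_mt dense}; rewrite /c1 /c2 {c1 c2}.
move: T ((2 * q) ^ k * t.+1) (2 ^ k.+1) (k.+1 ^ 3 * t.+1) => {}T a b d.
move: #|cycle_tuples _ _| (n ^ k) => C P c1_gt0 nc le_de.
have le_TC : P * T <= C.
  rewrite -(leq_pmul2l c1_gt0) -(leq_add2r (a * d * P)).
  apply: (@leq_trans (n * P)); last by apply: leq_trans le_de _; rewrite mulnDr !mulnA.
  by have := leq_mul nc (leqnn P); lia.
have := leq_mul (leqnn q) le_TC; lia.
Qed.

End SaturatedLowerBounds.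

(** * Polynomial bounds on the saturation number *)

Lemma sat_number_upper t r k n : 2 < r <= k.+1.*2.+1 -> t <= n -> 0 < n ->
  r * 2 * sat_number n (cycle_graph r) (complete_graph t.+2) <=
  #|[set J : {set 'I_r} | cyclic_stable J & #|J| == k.+1]| * t ^_ (r - k.+1) * n ^ k.+1
  + (\sum_(J : {set 'I_r}) t ^_ (r - #|J|)) * n ^ k.
Proof.
move=> /andP[r_gt2 le_rk] le_tn n_gt0.
apply: (@leq_trans (r * 2 * ncopies (cycle_graph r) (clique_join_empty t n))).
  by rewrite leq_mul2l sat_number_le ?join_saturated ?orbT.
rewrite -card_embeddings //; apply: leq_card_embeddings_join => // J /leq_cyclic_stable; lia.
Qed.

Definition asymp_upper (a : nat -> nat) (d M k : nat) :=
  exists c N, forall n, N <= n -> d * a n <= M * n ^ k.+1 + c * n ^ k.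

(** A lower bound with relative error [c / q] for every [q], written without
subtraction or division. *)
Definition asymp_lower (a : nat -> nat) (d M k : nat) :=
  exists c, forall q, 0 < q -> exists N, forall n, N <= n ->
    q * (n ^ k * M) <= q * (d * a n) + c * (n ^ k * M).

Section SatCycle.
Variables (t : nat).
Notation sat r := (fun n => sat_number n (cycle_graph r) (complete_graph t.+2)).

Lemma sat_upper_even k (r := k.+1.*2) : 0 < k ->
  asymp_upper (sat r) (r * 2) (2 * t ^_ k.+1) k.
Proof.
move=> k_gt0; exists (\sum_(J : {set 'I_r}) t ^_ (r - #|J|)), t.+1 => n le_tn.
have r_le : 2 < r <= k.+1.*2.+1 by rewrite /r; lia.
apply: leq_trans (@sat_number_upper t r k n r_le _ _) _; try lia.
have -> : r - k.+1 = k.+1 by rewrite /r; lia.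
by rewrite leq_add2r !leq_mul2r card_cyclic_stable_even ?orbT.
Qed.

Lemma sat_upper_odd k (r := k.+1.*2.+1) :
  asymp_upper (sat r) (r * 2) (r * t ^_ k.+2) k.
Proof.
exists (\sum_(J : {set 'I_r}) t ^_ (r - #|J|)), t.+1 => n le_tn.
have r_le : 2 < r <= k.+1.*2.+1 by rewrite /r; lia.
apply: leq_trans (@sat_number_upper t r k n r_le _ _) _; try lia.
have -> : r - k.+1 = k.+2 by rewrite /r; lia.
by rewrite leq_add2r !leq_mul2r card_cyclic_stable_odd ?orbT.
Qed.

Lemma sat_attained r n : exists2 G : sgraph 'I_n,
  saturated (complete_graph t.+2) G & ncopies (cycle_graph r) G = sat r n.
Proof. by apply: sat_number_attained; apply: complete_saturated_ex. Qed.

Lemma sat_lower_triangle : 1 < t -> asymp_lower (sat 3) 6 1 1.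
Proof.
move=> t_gt1; exists 1 => q q_gt0; exists (q * t.+1) => n le_n.
have [G satG <-] := sat_attained 3 n.
have := leq_triangle_copies satG t_gt1; rewrite card_ord expn1; nia.
Qed.

Lemma sat_lower_even m (k := m.+2) : m < t ->
  asymp_lower (sat k.*2) (k.*2 * 2) (t ^_ k) k.
Proof.
move=> lt_mt; exists k.+1 => q q_gt0.
exists (maxn (q * k ^ 3 * t.+1) (maxn ((2 * q) ^ k * t.+1 * (k.+1 ^ 3 * t.+1) +
   (2 * q) ^ k * t.+1 * 2 ^ k.+1 * t ^_ k) 1)) => n.
rewrite !geq_max => /and3P[n1 n2 n3]; have [G satG <-] := sat_attained k.*2 n.
by have := @leq_even_copies _ G t satG m q lt_mt q_gt0; rewrite card_ord -addnn; apply.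
Qed.

Lemma sat_lower_odd m (k := m.+2) (r := k.*2.+1) : k < t ->
  asymp_lower (sat r) (t.+1 * 2 ^ k * (r * 2)) (t ^_ k.+1) k.
Proof.
move=> lt_kt; exists 1 => q q_gt0.
exists (q * (t.+1 ^ 2 * k ^ 3 * t ^_ k.+1)).+1 => n le_n.
have [G satG <-] := sat_attained r n.
have := @leq_odd_copies _ G t satG m; rewrite card_ord -/k /=.
have -> : k + k.+1 = r by rewrite /r; lia.
have n_gt0 : 0 < n by apply: leq_ltn_trans le_n.
have T_gt0 : 0 < t ^_ k.+1 by rewrite ffact_gt0.
rewrite expnS; move: (ncopies _ _) le_n T_gt0; set c := _ * k ^ 3 * _.
move: c (t ^_ k.+1) (n ^ k) (t.+1 * 2 ^ k) => c T P B N le_n T_gt0 le_odd.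
rewrite -(leq_pmul2l n_gt0).
apply: (@leq_trans (q * (B * n * (r * 2 * N) + c * P))).
  by apply: leq_trans (leq_mul (leqnn q) le_odd); rewrite !mulnA (mulnC n q).
have h1 := leq_mul (ltnW le_n) (leqnn P).
have h2 := leq_mul (leqnn (n * P)) T_gt0; lia.
Qed.

End SatCycle.

(** * From polynomial bounds to the asymptotic statement *)

(** Used to compare the constant obtained for odd cycles, which has a factor
[2 ^ k] in its denominator, with the constant of the theorem. *)
Lemma leq_expn_fact_ffact j a : 2 * j <= a -> 2 ^ j * j`! <= a ^_ j.
Proof.
elim: j a => [|j IHj] a le_ja //; rewrite ffactnS expnS factS.
have := IHj a.-1; move: (2 ^ j) (j`!) (a.-1 ^_ j) => x y z.
by move=> /(_ ltac:(lia)) le_xyz; have := leq_mul le_ja le_xyz; lia.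
Qed.

From mathcomp Require Import all_classical all_reals all_analysis.
From mathcomp Require Import lra.
Import Order.TTheory GRing.Theory Num.Theory.
Import numFieldNormedType.Exports.
Local Open Scope classical_set_scope.
Local Open Scope ring_scope.

Section Asymptotics.
Variable R : realType.
Implicit Types (a p : nat -> R) (C : R).

(** The error term is the excess of [a] over the main term, which the hypothesis
bounds by every multiple of [p]. *)
Lemma exists_littleo_above a p C : 0 < C -> (forall n, 0 <= p n) ->
  (forall eps, 0 < eps -> \forall n \near \oo, a n <= C * (p n + eps * p n)) ->
  exists2 g : nat -> R, g =o_\oo p & \forall n \near \oo, a n <= C * (p n + g n).
Proof.
move=> C_gt0 p_ge0 le_a; exists (fun n => Num.max 0 (a n / C - p n)).
  apply/eqoP => eps eps_gt0; near=> n.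
  rewrite !ger0_norm ?le_max ?lexx //.
  rewrite ge_max mulr_ge0 ?(ltW eps_gt0) //= lerBlDl ler_pdivrMr // mulrC.
  by near: n; apply: le_a.
near=> n; rewrite mulrC -ler_pdivrMr // -lerBlDl.
by rewrite le_max lexx orbT.
Unshelve. all: by end_near.
Qed.

Lemma exists_littleo_below a p C : 0 < C -> (forall n, 0 <= p n) ->
  (forall eps, 0 < eps -> \forall n \near \oo, C * (p n - eps * p n) <= a n) ->
  exists2 f : nat -> R, f =o_\oo p & \forall n \near \oo, C * (p n - f n) <= a n.
Proof.
move=> C_gt0 p_ge0 le_a; exists (fun n => Num.max 0 (p n - a n / C)).
  apply/eqoP => eps eps_gt0; near=> n.
  rewrite !ger0_norm ?le_max ?lexx //.
  rewrite ge_max mulr_ge0 ?(ltW eps_gt0) //= lerBlDl -lerBlDr ler_pdivlMr // mulrC.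
  by near: n; apply: le_a.
near=> n; rewrite mulrC -ler_pdivlMr // lerBlDl -lerBlDr.
by rewrite le_max lexx orbT.
Unshelve. all: by end_near.
Qed.

Lemma asymp_upperP (a : nat -> nat) (d M k : nat) : (0 < d)%N -> (0 < M)%N ->
  asymp_upper a d M k -> forall eps : R, 0 < eps ->
  \forall n \near \oo, (a n)%:R <= M%:R / d%:R *
     (n%:R ^+ k.+1 + eps * n%:R ^+ k.+1).
Proof.
move=> d_gt0 M_gt0 [c [N le_a]] eps eps_gt0; near=> n.
have le_an : (d * a n <= M * n ^ k.+1 + c * n ^ k)%N.
  by apply: le_a; near: n; apply: nbhs_infty_ge.
have d0 : 0 < d%:R :> R by rewrite ltr0n.
have M0 : 0 < M%:R :> R by rewrite ltr0n.
have le_cn : c%:R / (M%:R * eps) <= n%:R :> R by near: n; apply: nbhs_infty_ger.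
rewrite -mulrA [_^-1 * _]mulrC mulrA ler_pdivlMr // mulrC mulrDr.
rewrite -!natrX; apply: (@le_trans _ _ (M%:R * (n ^ k.+1)%:R + c%:R * (n ^ k)%:R)).
  by rewrite -!natrM -natrD ler_nat.
rewrite lerD2l expnS natrM !mulrA ler_wpM2r ?ler0n // -mulrA.
by move: le_cn; rewrite ler_pdivrMr ?mulr_gt0 // => /le_trans; apply; rewrite mulrC mulrA.
Unshelve. all: by end_near.
Qed.

Lemma asymp_lowerP (a : nat -> nat) (d M k : nat) : (0 < d)%N -> (0 < M)%N ->
  asymp_lower a d M k -> forall eps : R, 0 < eps ->
  \forall n \near \oo, M%:R / d%:R * (n%:R ^+ k - eps * n%:R ^+ k) <= (a n)%:R.
Proof.
move=> d_gt0 M_gt0 [c le_a] eps eps_gt0.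
have d0 : 0 < d%:R :> R by rewrite ltr0n.
have M0 : 0 < M%:R :> R by rewrite ltr0n.
have [q q_gt0 le_q] : exists2 q : nat, (0 < q)%N & c%:R / eps <= q%:R :> R.
  have [N _ HN] := nbhs_infty_ger (c%:R / eps); exists N.+1 => //.
  by apply: HN => /=.
have [N le_aN] := le_a q q_gt0; near=> n.
have q0 : 0 < q%:R :> R by rewrite ltr0n.
have : (q * (n ^ k * M) <= q * (d * a n) + c * (n ^ k * M))%N.
  by apply: le_aN; near: n; apply: nbhs_infty_ge.
rewrite -(ler_nat R) natrD !natrM natrX => le_n.
rewrite mulrAC ler_pdivrMr // -(ler_pM2l q0).
have : c%:R * (n%:R ^+ k * M%:R) <= q%:R * eps * (n%:R ^+ k * M%:R) :> R.
  by rewrite ler_wpM2r ?mulr_ge0 ?exprn_ge0 ?ler0n // -ler_pdivrMr.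
lra.
Unshelve. all: by end_near.
Qed.

Lemma eqTheta_pow (a : nat -> nat) (C C' : R) k : 0 < C -> 0 < C' ->
  (\forall n \near \oo, C * (n%:R ^+ k - 2^-1 * n%:R ^+ k) <= (a n)%:R) ->
  (\forall n \near \oo, (a n)%:R <= C' * (n%:R ^+ k + 1 * n%:R ^+ k)) ->
  (fun n => (a n)%:R : R) =Theta_\oo (fun n => n%:R ^+ k).
Proof.
move=> C0 C'0 lo up; rewrite eqThetaE qualifE; apply/asboolP.
exists (C / 2, C' * 2) => /=; first by rewrite divr_gt0 // mulr_gt0.
near=> n; rewrite !ger0_norm ?exprn_ge0 ?ler0n //; split.
  have : C * (n%:R ^+ k - 2^-1 * n%:R ^+ k) <= (a n)%:R by near: n.
  lra.
have : (a n)%:R <= C' * (n%:R ^+ k + 1 * n%:R ^+ k) by near: n.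
lra.
Unshelve. all: by end_near.
Qed.

End Asymptotics.

Theorem theorem1p7 (R : realType) (s r : nat) :
  (5 <= s)%N -> (3 <= r)%N -> (r <= 2 * s - 4)%N ->
  let k := (r %/ 2)%N in
  let satn : nat -> R :=
    fun n => (sat_number n (cycle_graph r) (complete_graph s))%:R in
  let npow : nat -> R := fun n => n%:R ^+ k in
  (satn =Theta_\oo npow)
  /\ (~~ odd r ->
      (exists2 f : nat -> R, f =o_\oo npow &
         \forall n \near \oo,
           ((s - 2) ^_ k)%:R / (4 * k)%:R * (npow n - f n) <= satn n)
      /\ (exists2 g : nat -> R, g =o_\oo npow &
         \forall n \near \oo,
           satn n <= ((s - 2) ^_ k)%:R / (2 * k)%:R * (npow n + g n)))
  /\ (odd r ->
      ((5 <= r)%N ->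
       exists2 f : nat -> R, f =o_\oo npow &
         \forall n \near \oo,
           ((s - 2) ^_ k.+1 * (k - 2)`!)%:R
             / (r * (r - 3) * r ^_ k * (s - 1))%:R * (npow n - f n) <= satn n)
      /\ (exists2 g : nat -> R, g =o_\oo npow &
         \forall n \near \oo,
           satn n <= ((s - 2) ^_ k.+1)%:R / 2%:R * (npow n + g n))).
Proof.
case: s => [|[|t]] // le_5s le_3r le_rs.
have t_ge3 : (3 <= t)%N by [].
have {}le_rs : (r <= 2 * t)%N by lia.
have -> : (t.+2 - 2 = t)%N by lia.
have -> : (t.+2 - 1 = t.+1)%N by lia.
have pow_ge0 k n : 0 <= n%:R ^+ k :> R by rewrite exprn_ge0.
have div2E : (r %/ 2)%N = r./2 by rewrite divn2.
rewrite div2E; have := odd_double_half r; case: (odd r) => /=; last first.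
  rewrite add0n; case: r./2 => [|[|m]] def_r; [lia | lia | ].
  rewrite -{r div2E}def_r in le_3r le_rs *; set k := m.+2.
  have T_gt0 : (0 < t ^_ k)%N by rewrite ffact_gt0; lia.
  have T2_gt0 : (0 < 2 * t ^_ k)%N by rewrite muln_gt0.
  have d_gt0 : (0 < k.*2 * 2)%N by [].
  have lt_mt : (m < t)%N by lia.
  have up := asymp_upperP (R := R) d_gt0 T2_gt0 (@sat_upper_even t m.+1 isT).
  have lo := asymp_lowerP (R := R) d_gt0 T_gt0 (@sat_lower_even t m lt_mt).
  rewrite -/k in up lo.
  have E1 : (2 * t ^_ k)%:R / (k.*2 * 2)%:R = (t ^_ k)%:R / (2 * k)%:R :> R.
    rewrite (_ : k.*2 * 2 = 2 * (2 * k))%N; last by lia.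
    by rewrite [in LHS]natrM [X in _ / X]natrM -mulf_div divff ?pnatr_eq0 // mul1r.
  have E2 : (k.*2 * 2 = 4 * k)%N by lia.
  rewrite {}E1 in up; rewrite {}E2 in lo.
  have Cu : 0 < (t ^_ k)%:R / (2 * k)%:R :> R by rewrite divr_gt0 ?ltr0n.
  have Cl : 0 < (t ^_ k)%:R / (4 * k)%:R :> R by rewrite divr_gt0 ?ltr0n.
  split; first by apply: (eqTheta_pow Cl Cu); [apply: lo | apply: up].
  split=> // _; split; first exact: exists_littleo_below.
  exact: exists_littleo_above.
rewrite add1n; case: r./2 => [|m] def_r; first by lia.
rewrite -{r div2E}def_r in le_3r le_rs *; set k := m.+1; set r := k.*2.+1.
have T_gt0 : (0 < t ^_ k.+1)%N by rewrite ffact_gt0 /k; lia.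
have rT_gt0 : (0 < r * t ^_ k.+1)%N by rewrite muln_gt0.
have up := asymp_upperP (R := R) (isT : (0 < r * 2)%N) rT_gt0 (@sat_upper_odd t m).
rewrite -/k -/r in up.
have E1 : (r * t ^_ k.+1)%:R / (r * 2)%:R = (t ^_ k.+1)%:R / 2 :> R.
  by rewrite !natrM -mulf_div divff ?pnatr_eq0 // mul1r.
rewrite {}E1 in up.
have Cu : 0 < (t ^_ k.+1)%:R / 2 :> R by rewrite divr_gt0 ?ltr0n.
case: m @k @r le_3r le_rs T_gt0 rT_gt0 up Cu => [|m] k r le_3r le_rs T_gt0 rT_gt0 up Cu.
  (* For r = 3 only the order of magnitude is claimed from below. *)
  have t_gt1 : (1 < t)%N by lia.
  have lo := asymp_lowerP (R := R) (isT : (0 < 6)%N) (isT : (0 < 1)%N) (sat_lower_triangle t_gt1).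
  have Cl : 0 < 1 / 6 :> R by rewrite divr_gt0.
  split; first by apply: (eqTheta_pow Cl Cu); [apply: lo | apply: up].
  split=> // _; split=> //; exact: exists_littleo_above.
have lt_kt : (k < t)%N by rewrite /k; lia.
have d_gt0 : (0 < t.+1 * 2 ^ k * (r * 2))%N by rewrite muln_gt0 muln_gt0 expn_gt0.
have lo := asymp_lowerP (R := R) d_gt0 T_gt0 (@sat_lower_odd t m lt_kt).
rewrite -/k -/r in lo.
set C := _ / _ in lo.
have Cl : 0 < C by rewrite divr_gt0 ?ltr0n.
split; first by apply: (eqTheta_pow Cl Cu); [apply: lo | apply: up].
split=> // _; split; last exact: exists_littleo_above.
move=> _; set C' := _ / _.
have D_gt0 : (0 < r * (r - 3) * r ^_ k * t.+1)%N.
  by rewrite !muln_gt0 ffact_gt0 /r; lia.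
have C'_gt0 : 0 < C' by rewrite divr_gt0 ?ltr0n // muln_gt0 T_gt0 fact_gt0.
have le_C : C' <= C.
  rewrite /C' /C ler_pdivrMr ?ltr0n // mulrAC ler_pdivlMr ?ltr0n //.
  rewrite -!natrM ler_nat.
  have : (2 ^ k * k`! <= r ^_ k)%N by apply: leq_expn_fact_ffact; rewrite /r; lia.
  have : ((k - 2)`! <= k`!)%N by apply: leq_fact; lia.
  move: (t ^_ k.+1) (2 ^ k)%N (k - 2)`! k`! (r ^_ k) => T x y z w le_yz le_xzw.
  have : (x * y <= w)%N by apply: leq_trans le_xzw; rewrite leq_mul2l le_yz orbT.
  have : (2 <= r - 3)%N by rewrite /r /k; lia.
  move: (r - 3)%N => u le_u le_xy; have := leq_mul le_u le_xy.
  by move=> /(leq_mul (leqnn (T * r * t.+1))); lia.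
apply: exists_littleo_below => // eps eps_gt0.
(* For eps <= 1 the constant can be lowered from C to C'; for eps > 1 the left
   side is not positive. *)
have [eps_le1|eps_gt1] := leP eps 1.
  near=> n; apply: (@le_trans _ _ (C * (n%:R ^+ k - eps * n%:R ^+ k))).
    by rewrite ler_wpM2r // subr_ge0 ler_piMl.
  by near: n; apply: lo.
near=> n; apply: (@le_trans _ _ 0); last exact: ler0n.
rewrite mulr_ge0_le0 ?(ltW C'_gt0) // subr_le0 ler_peMl // ltW //.
Unshelve. all: by end_near.
Qed.
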